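(* Let $p$ be a prime and let $c$ be an integer. Then \[ \sum_{\substack{r\in\mathbb{Z},\ |r|<2\sqrt p,\\ r\equiv c\pmod 3}}H(4p-r^2) =\begin{cases} \frac{p+1}{2}, &\text{if } c\equiv 0\pmod 3,\ p\equiv 1\pmod 3,\\ p-1, &\text{if } c\equiv 0\pmod 3,\ p\equiv 2\pmod 3,\\ \frac{3p-1}{4}, &\text{if } c\equiv\pm 1\pmod 3,\ p\equiv 1\pmod 3,\\ \frac{p+1}{2}, &\text{if } c\equiv\pm 1\pmod 3,\ p\equiv 2\pmod 3. \end{cases} \]
   Context: $H(N)$ denotes the Hurwitz class number: for an integer $N\ge 0$, $H(0)=-1/12$; $H(N)=0$ if $N\equiv 1,2\pmod 4$; otherwise $H(N)$ is the number of $\mathrm{SL}_2(\mathbb{Z})$-equivalence classes of (not necessarily primitive) positive definite binary quadratic forms of discriminant $-N$, where classes containing a multiple of $x^2+y^2$ are counted with weight $1/2$ and classes containing a multiple of $x^2+xy+y^2$ are counted with weight $1/3$. The sum runs over all integers $r$ (positive, negative and zero) satisfying the stated conditions. *)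

(* Defs.v *)
From Stdlib Require Import ClassicalEpsilon ClassicalDescription.
From mathcomp Require Import all_boot all_order all_algebra.
Set Implicit Arguments. Unset Strict Implicit. Unset Printing Implicit Defensive.
Import Order.TTheory GRing.Theory Num.Theory.
Local Open Scope ring_scope.

(* A binary quadratic form a x^2 + b x y + c y^2 with integer coefficients. *)
Definition bqf := (int * int * int)%type.
Definition qa (f : bqf) : int := f.1.1.
Definition qb (f : bqf) : int := f.1.2.
Definition qc (f : bqf) : int := f.2.

Definition disc (f : bqf) : int := qb f ^+ 2 - 4 * qa f * qc f.

Definition posdef_disc (N : nat) (f : bqf) : Prop :=
  disc f = - (N%:Z) /\ 0 < qa f /\ 0 < qc f.

(* f(al x + be y, ga x + de y) *)
Definition bqf_act (f : bqf) (al be ga de : int) : bqf :=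
  (qa f * al ^+ 2 + qb f * al * ga + qc f * ga ^+ 2,
   2 * qa f * al * be + qb f * (al * de + be * ga) + 2 * qc f * ga * de,
   qa f * be ^+ 2 + qb f * be * de + qc f * de ^+ 2).

Definition sl2_equiv (f g : bqf) : Prop :=
  exists al be ga de : int, al * de - be * ga = 1 /\ g = bqf_act f al be ga de.

Definition class_has_mult_sq (f : bqf) : Prop :=
  exists k : int, sl2_equiv f (k, 0, k).
Definition class_has_mult_hex (f : bqf) : Prop :=
  exists k : int, sl2_equiv f (k, k, k).

Definition class_weight (f : bqf) : rat :=
  if excluded_middle_informative (class_has_mult_sq f) then 1 / 2
  else if excluded_middle_informative (class_has_mult_hex f) then 1 / 3
  else 1.

Definition is_weighted_class_count (N : nat) (h : rat) : Prop :=
  exists s : seq bqf,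
    (forall f, f \in s -> posdef_disc N f) /\
    (forall i j, (i < size s)%N -> (j < size s)%N ->
        sl2_equiv (nth (0,0,0) s i) (nth (0,0,0) s j) -> i = j) /\
    (forall g, posdef_disc N g -> exists2 f, f \in s & sl2_equiv f g) /\
    h = \sum_(f <- s) class_weight f.

Definition Hurwitz_spec (N : nat) (h : rat) : Prop :=
  if N == 0%N then h = - (1 / 12)
  else if (N %% 4 == 1)%N || (N %% 4 == 2)%N then h = 0
  else is_weighted_class_count N h.

Definition H (N : nat) : rat := epsilon (inhabits 0) (Hurwitz_spec N).

(* Main.v *)
(* A matrix N of determinant p and trace r with r^2 < 4p fixes one point of the upper half plane, the root
   of a binary form of discriminant r^2 - 4p.  By Selling reduction each class contains essentially three
   forms whose root lies in a given ideal triangle of the Farey tessellation, so 3 H(4p - r^2) counts the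
   matrices of trace r whose fixed point lies in that triangle, a point on the boundary counting 1/2.

   Cutting an ideal polygon into translates of the triangle turns such counts into an elementary
   Lefschetz fixed point formula: the count is a sum over the edges of the polygon of signs depending only
   on how N moves the two endpoints.  Summed over all matrices in a large set that is invariant under the
   rotations of the polygon, the generic terms cancel and only the matrices sending a vertex to itself or
   to an adjacent vertex contribute; these have a zero entry in a suitable basis and are counted directly.

   The quadrilateral with cusps 0, 1/2, 1, oo gives the sum over all traces.  Applied to the matrices that
   modulo 3 lie in the quaternion subgroup of SL_2(F_3) when p = 1 mod 3, and, with a hexagon, to the
   matrices that are upper triangular modulo 3, the same formula yields further linear relations between the
   sums over the traces divisible by 3, over the traces prime to 3, and over the scalar matrices modulo 3,
   since the trace modulo 3 determines the number of fixed points on P^1(F_3) of a non-scalar matrix. *)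

Require Import Defs.
From Stdlib Require Import ClassicalEpsilon ClassicalDescription ZArith Lia.
From mathcomp Require Import all_boot all_order all_algebra.
Import Order.TTheory GRing.Theory Num.Theory.

(** * Signs at one edge and around one ideal triangle *)

Section SignAnalysis.
Local Open Scope Z_scope.
(** A purely linear description of [edge]: every product of signs is resolved into sign conditions,
    so that [lia] can work with it. What remains of the positive determinant is that [al], [de] have
    equal signs or [be], [ga] have opposite signs. *)
Definition edge_spec (al be ga de e : Z) : Prop :=
  (0 < al /\ 0 < de /\ e = Z.sgn (be + ga)) \/
  (al < 0 /\ de < 0 /\ e = - Z.sgn (be + ga)) \/
  (0 < be /\ ga < 0 /\
    ((0 < al /\ de < 0 /\ e = -1) \/ (al < 0 /\ 0 < de /\ e = 1) \/
     (al = 0 /\ - ga < be /\ e = Z.sgn de) \/ (al = 0 /\ be < - ga /\ e = 0) \/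
     (al <> 0 /\ de = 0 /\ - ga < be /\ e = 0) \/ (al <> 0 /\ de = 0 /\ be < - ga /\ e = - Z.sgn al))) \/
  (be < 0 /\ 0 < ga /\
    ((0 < al /\ de < 0 /\ e = 1) \/ (al < 0 /\ 0 < de /\ e = -1) \/
     (al = 0 /\ ga < - be /\ e = - Z.sgn de) \/ (al = 0 /\ - be < ga /\ e = 0) \/
     (al <> 0 /\ de = 0 /\ ga < - be /\ e = 0) \/ (al <> 0 /\ de = 0 /\ - be < ga /\ e = Z.sgn al))).
Definition hsel_spec (X Y Z h : Z) :=
  (X < 0 /\ h = 0) \/ (Y < 0 /\ h = 0) \/ (Z < 0 /\ h = 0) \/
  (0 < X /\ 0 < Y /\ 0 < Z /\ h = 2) \/ (X = 0 /\ 0 < Y /\ 0 < Z /\ h = 1) \/ (0 < X /\ 0 = Y /\ 0 < Z /\ h = 1) \/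
  (0 < X /\ 0 < Y /\ 0 = Z /\ h = 1).
Ltac prune := try (exfalso; lia).
Ltac destruct_edge_spec h := destruct h as [[? [? ?]]|[[? [? ?]]|[[? [? h]]|[? [? h]]]]]; prune.

(** All quantities are linear in a, b, c, d, and the determinant enters only through the disjuncts
    of [edge_spec], so the identity splits into finitely many linear problems. *)
Lemma edge_triangle_Z (a b c d e1 e2 e3 h1 h2 x1 x2 x3 x4 x5 x6 x7 y1 y2 y3 z1 z2 z3 : Z) :
  edge_spec x1 x2 x3 x4 e1 -> edge_spec x4 x5 x6 c e2 -> edge_spec c x7 a x1 e3 ->
  hsel_spec y1 y2 y3 h1 -> hsel_spec z1 z2 z3 h2 ->
  x1 = - b -> x2 = - (a + b) -> x3 = d - b -> x4 = c + d - (a + b) -> x5 = c - a -> x6 = c + d ->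
  x7 = - d -> y1 = a - d -> y2 = 2 * c - (a - d) -> y3 = - 2 * b - (a - d) ->
  z1 = - y1 -> z2 = - y2 -> z3 = - y3 ->
  e1 + e2 + e3 = 1 + h1 + h2.
Proof.
intros s1 s2 s3 H1 H2; intros; subst.
destruct_edge_spec s1; destruct_edge_spec s3; destruct_edge_spec s2.
all: destruct H1 as [H1|[H1|[H1|[H1|[H1|[H1|H1]]]]]]; prune;
 destruct H2 as [H2|[H2|[H2|[H2|[H2|[H2|H2]]]]]]; prune.
all: try lia.
Qed.
End SignAnalysis.

From mathcomp Require Import zify ring lra ssrZ.
Local Open Scope ring_scope.

(* The contribution to the fixed point index of M of an edge from x to y, where al, be, ga, de are
   x^Mx, x^My, y^Mx, y^My and x^y is the determinant of x and y.  The degenerate branches are chosen so that [edge_triangle] holds. *)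
Definition edge (al be ga de : int) : int :=
  if al == 0 then (if `|ga| < `|be| then sgz be * sgz de else 0)
  else if de == 0 then (if `|be| < `|ga| then sgz al * sgz ga else 0)
  else if be == 0 then sgz al * sgz ga
  else if ga == 0 then sgz be * sgz de
  else if sgz al * sgz ga == sgz be * sgz de then sgz al * sgz ga
  else sgz al * sgz (be + ga).

Lemma det_gt0_signs (x y z t p : int) : 0 < p -> x * t - y * z = p ->
  (0 < x /\ 0 < t) \/ (x < 0 /\ t < 0) \/ (0 < y /\ z < 0) \/ (y < 0 /\ 0 < z).
Proof.
move=> p0 e.
case: (ltrgt0P x) => hx; case: (ltrgt0P t) => ht; case: (ltrgt0P y) => hy; case: (ltrgt0P z) => hz;
  try (by lia); exfalso; subst; nia.
Qed.

Ltac pick_or := lazymatch goal with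
  | |- _ \/ _ => (left; solve [pick_or]) || (right; pick_or)
  | |- _ /\ _ => split; [solve [pick_or] | pick_or]
  | _ => lia end.

Lemma edgeP (p al be ga de : int) :
  0 < p -> (forall x, x * x <> p) -> al * de - be * ga = p -> edge_spec (Z_of_int al) (Z_of_int be) (Z_of_int ga) (Z_of_int de) (Z_of_int (edge al be ga de)).
Proof.
move=> p0 psq hp.
have hs := det_gt0_signs _ _ _ _ _ p0 hp.
(* When a diagonal entry vanishes the determinant is [- be * ga]: then [be = - ga] would make p a
   square and [be = ga] would make it nonpositive. So the comparison of absolute values in [edge] is
   strict. *)
have ht : (al = 0 \/ de = 0) -> be <> ga /\ be <> - ga.
  by move=> h; split=> h2; apply: (psq ga); case: h => h; move: hp; rewrite h h2 ?mul0r ?mulr0; nia.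
clear hp.
move E : (edge al be ga de) => e; move: E; rewrite /edge /edge_spec.
case: (sgzP al) hs ht => hal; case: (sgzP be) => hbe; case: (sgzP ga) => hga; case: (sgzP de) => hde hs ht;
  try (by exfalso; clear -hs hal hbe hga hde; lia); subst.
all: do ?[case: eqP => ?]; do ?[case: ifP => ?] => he; try (by exfalso; lia).
all: pick_or.
Qed.

(* Twice the weight of a point of the closed triangle with coordinates X, Y, Z: 1 inside, 1/2 on a side. *)
Definition hsel (X Y Z : int) : int :=
  if (X < 0) || (Y < 0) || (Z < 0) then 0 else 2 - (X == 0)%:Z - (Y == 0)%:Z - (Z == 0)%:Z.

Lemma hselP X Y Z : ~ (X = 0 /\ Y = 0) -> ~ (X = 0 /\ Z = 0) -> ~ (Y = 0 /\ Z = 0) ->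
  hsel_spec (Z_of_int X) (Z_of_int Y) (Z_of_int Z) (Z_of_int (hsel X Y Z)).
Proof.
move=> n1 n2 n3; rewrite /hsel_spec /hsel; case: ifP => [/orP[/orP[h|h]|h]|h]; [pick_or|pick_or|pick_or|].
case: (X =P 0) => ?; case: (Y =P 0) => ?; case: (Z =P 0) => ?; pick_or.
Qed.

(** The triangle has the cusps (0, 1), (1, 1), (1, 0) and closes up at -(0, 1). The two [hsel] terms
    test the form of the matrix and its negative, either of which may be the positive definite
    one. *)
Lemma edge_triangle (a b c d p : int) : 0 < p -> (forall x, x * x <> p) -> a * d - b * c = p ->
  edge (- b) (- (a + b)) (d - b) (c + d - (a + b)) +
  edge (c + d - (a + b)) (c - a) (c + d) c + edge c (- d) a (- b)
  = 1 + hsel (a - d) (2 * c - (a - d)) (- 2 * b - (a - d))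
  + hsel (d - a) ( (a - d) - 2 * c ) ((a - d) + 2 * b).
Proof.
move=> p0 psq hp.
(* If two of the three coordinates vanish, the characteristic polynomial has a double root and p is
   a square. *)
have n1 : ~ (a = d /\ c = 0) by move=> [h1 h2]; apply: (psq a); move: hp; rewrite h2 mulr0 subr0 -h1.
have n2 : ~ (a = d /\ b = 0) by move=> [h1 h2]; apply: (psq a); move: hp; rewrite h2 mul0r subr0 -h1.
have n3 : ~ (2 * c = a - d /\ c = - b).
  move=> [h1 h2]; apply: (psq (a + b)); rewrite -hp.
  have -> : a = d - 2 * b by lia.
  by rewrite h2; ring.
have e1 := edgeP p (- b) (- (a + b)) (d - b) (c + d - (a + b)) p0 psq ltac:(rewrite -hp; ring).
have e2 := edgeP p (c + d - (a + b)) (c - a) (c + d) c p0 psq ltac:(rewrite -hp; ring).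
have e3 := edgeP p c (- d) a (- b) p0 psq ltac:(rewrite -hp; ring).
have := hselP (a - d) (2 * c - (a - d)) (- 2 * b - (a - d)).
have := hselP (d - a) ( (a - d) - 2 * c ) ((a - d) + 2 * b).
move: (hsel _ _ _) (hsel _ _ _) (edge _ _ _ _) (edge _ _ _ _) (edge _ _ _ _) e1 e2 e3 => H1 H2 E1 E2 E3 e1 e2 e3.
move=> /(_ ltac:(lia) ltac:(lia) ltac:(lia)) f1 /(_ ltac:(lia) ltac:(lia) ltac:(lia)) f2.
have := edge_triangle_Z _ (Z_of_int b) _ (Z_of_int d) _ _ _ _ _ _ _ _ _ _ _ _ _ _ _ _ _ _ e1 e2 e3 f2 f1.
do 13 (move=> /(_ ltac:(lia))); lia.
Qed.

(** * Reindexing of finite sums *)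

Set Implicit Arguments. Unset Strict Implicit. Unset Printing Implicit Defensive.

(** The maps need to be mutually inverse only where the terms do not vanish, which allows sums over
    finite boxes of different shapes to be compared. *)
Lemma sum_reindex (R : nmodType) (T1 T2 : eqType) (s1 : seq T1) (s2 : seq T2) (f : T1 -> T2) (g : T2 -> T1)
    (F1 : T1 -> R) (F2 : T2 -> R) :
  uniq s1 -> uniq s2 ->
  (forall x, x \in s1 -> F1 x != 0 -> [/\ f x \in s2, F2 (f x) = F1 x & g (f x) = x]) ->
  (forall y, y \in s2 -> F2 y != 0 -> [/\ g y \in s1, F1 (g y) = F2 y & f (g y) = y]) ->
  \sum_(x <- s1) F1 x = \sum_(y <- s2) F2 y.
Proof.
move=> u1 u2 h1 h2.
have r T (s : seq T) (F : T -> R) : \sum_(x <- s) F x = \sum_(x <- [seq x <- s | F x != 0]) F x.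
  by rewrite big_filter [RHS]big_mkcond /=; apply: eq_bigr => x _; case: eqP.
rewrite (r _ s1) (r _ s2).
have P : perm_eq [seq f x | x <- s1 & F1 x != 0] [seq y <- s2 | F2 y != 0].
  apply: uniq_perm; rewrite ?filter_uniq //.
    rewrite map_inj_in_uniq ?filter_uniq // => x y; rewrite !mem_filter => /andP[nx xs] /andP[ny ys] e.
    have [_ _ <-] := h1 x xs nx; have [_ _ <-] := h1 y ys ny; by rewrite e.
  move=> y; apply/mapP/idP => [[x]|]; rewrite mem_filter => /andP[nx xs].
    move=> ->; have [a b _] := h1 x xs nx; by rewrite mem_filter a b nx.
  have [a b c] := h2 y xs nx; exists (g y); by rewrite ?c // mem_filter a b nx.
rewrite -(perm_big _ P) big_map; apply: eq_big_seq => x; rewrite mem_filter => /andP[nx xs].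
by have [_ -> _] := h1 x xs nx.
Qed.

Lemma sum_sign_reversing (T : eqType) (s : seq T) (f : T -> T) (F : T -> int) :
  uniq s -> (forall x, x \in s -> F x != 0 -> [/\ f x \in s, F (f x) = - F x & f (f x) = x]) ->
  \sum_(x <- s) F x = 0.
Proof.
move=> us h.
suff : \sum_(x <- s) F x = \sum_(x <- s) - F x by rewrite sumrN; move: (\sum_(x <- s) F x) => S; lia.
apply: (sum_reindex (f := f) (g := f)) => // x xs; rewrite ?oppr_eq0 => nz; have [a b c] := h x xs nz;
 by split=> //; lia.
Qed.

Lemma sum_periodic (m l : nat) (g : nat -> int) : (forall j, g (j + m)%N = g j) ->
  \sum_(j < m) g (l + j)%N = \sum_(j < m) g j.
Proof.
move=> per; elim: l => [|l IH]; first by apply: eq_bigr.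
rewrite -IH; case: m per {IH} => [|m] per; first by rewrite !big_ord0.
rewrite big_ord_recr big_ord_recl /= [RHS]addrC addn0; congr (_ + _).
  by apply: eq_bigr => i _; congr g; rewrite addSnnS.
by rewrite addSnnS per.
Qed.

(** * Matrices, edges and polygons *)

Definition vec := (int * int)%type.
Definition mat := (int * int * int * int)%type.
Definition M11 (M : mat) := M.1.1.1.
Definition M12 (M : mat) := M.1.1.2.
Definition M21 (M : mat) := M.1.2.
Definition M22 (M : mat) := M.2.
Definition wedge (x y : vec) : int := x.1 * y.2 - x.2 * y.1.
Definition mact (M : mat) (x : vec) : vec := (M11 M * x.1 + M12 M * x.2, M21 M * x.1 + M22 M * x.2).
Definition mmul (M N : mat) : mat :=
  (M11 M * M11 N + M12 M * M21 N, M11 M * M12 N + M12 M * M22 N,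
   M21 M * M11 N + M22 M * M21 N, M21 M * M12 N + M22 M * M22 N).
Definition mdet (M : mat) : int := M11 M * M22 M - M12 M * M21 M.
Definition mtr (M : mat) : int := M11 M + M22 M.
Definition vopp (x : vec) : vec := (- x.1, - x.2).
Definition vlin (k : int) (x y : vec) : vec := (k * x.1 - y.1, k * x.2 - y.2).

Ltac munf := rewrite /mmul /mdet /mtr /wedge /mact /vopp /vlin /M11 /M12 /M21 /M22 /=.

Lemma mact_mul M N x : mact (mmul M N) x = mact M (mact N x).
Proof. by munf; congr (_, _); ring. Qed.

Lemma mdet_mul M N : mdet (mmul M N) = mdet M * mdet N.
Proof. munf; ring. Qed.

(* The matrix with entries N with respect to the basis x, y, when wedge x y = -1. *)
Definition frame (x y : vec) (N : mat) : mat :=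
  mmul (mmul (x.1, y.1, x.2, y.2) N) (- y.2, y.1, x.2, - x.1).
Definition unframe (x y : vec) (M : mat) : mat :=
  (wedge y (mact M x), wedge y (mact M y), - wedge x (mact M x), - wedge x (mact M y)).

Lemma frame_mtr x y N : wedge x y = -1 -> mtr (frame x y N) = mtr N.
Proof.
move=> h; have -> : mtr (frame x y N) = - wedge x y * mtr N by rewrite /frame; munf; ring.
by rewrite h; ring.
Qed.

Lemma frame_mdet x y N : wedge x y = -1 -> mdet (frame x y N) = mdet N.
Proof.
move=> h; have -> : mdet (frame x y N) = wedge x y * wedge x y * mdet N by rewrite /frame; munf; ring.
by rewrite h; ring.
Qed.

Lemma frameK x y N : wedge x y = -1 -> unframe x y (frame x y N) = N.
Proof.
case: N => [[[a b] c] d] h.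
have h2 : wedge x y * wedge x y = 1 by rewrite h.
rewrite -[RHS]/(a, b, c, d).
have -> : unframe x y (frame x y (a, b, c, d)) =
  (wedge x y * wedge x y * a, wedge x y * wedge x y * b, wedge x y * wedge x y * c, wedge x y * wedge x y * d).
  by rewrite /unframe /frame; munf; congr (_, _, _, _); ring.
by rewrite h2 !mul1r.
Qed.

Lemma unframeK x y M : wedge x y = -1 -> frame x y (unframe x y M) = M.
Proof.
case: M => [[[a b] c] d] h.
have h2 : wedge x y * wedge x y = 1 by rewrite h.
have -> : frame x y (unframe x y (a, b, c, d)) =
  (wedge x y * wedge x y * a, wedge x y * wedge x y * b, wedge x y * wedge x y * c, wedge x y * wedge x y * d).
  by rewrite /unframe /frame; munf; congr (_, _, _, _); ring.
by rewrite h2 !mul1r.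
Qed.

(** For [wedge x y = -1] this is -1 on the open arc of cusps containing the mediant x + y, +1 on the
    complementary open arc, and 0 at x and y. *)
Definition side (x y z : vec) : int := sgz (wedge z x) * sgz (wedge z y).
Definition edgeM (M : mat) (x y : vec) : int :=
  edge (wedge x (mact M x)) (wedge x (mact M y)) (wedge y (mact M x)) (wedge y (mact M y)).
(** The value of [edge] when Mx and My are strictly separated by the edge; for a positive
    determinant this means that [al * de] is positive and [be * ga] negative. *)
Definition cross (al be ga de : int) : int :=
  if ((0 < al) && (0 < de) || (al < 0) && (de < 0)) && ((0 < be) && (ga < 0) || (be < 0) && (0 < ga))
  then sgz al * sgz (be + ga) else 0.
Definition crossM (M : mat) (x y : vec) : int :=
  cross (wedge x (mact M x)) (wedge x (mact M y)) (wedge y (mact M x)) (wedge y (mact M y)).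

(* Corrections to the generic value of [edge]: M sends an endpoint to the other one, or fixes an endpoint. *)
Definition adj1 M x y : int := (wedge x (mact M y) == 0)%:Z * side x y (mact M x).
Definition adj2 M x y : int := (wedge y (mact M x) == 0)%:Z * side x y (mact M y).
Definition fix1 M x y : int :=
  (wedge x (mact M x) == 0)%:Z * sgz (`|wedge x (mact M y)| - `|wedge y (mact M x)|) * side x y (mact M y).
Definition fix2 M x y : int :=
  (wedge y (mact M y) == 0)%:Z * sgz (`|wedge y (mact M x)| - `|wedge x (mact M y)|) * side x y (mact M x).

Lemma wedgeC x y : wedge x y = - wedge y x.
Proof. rewrite /wedge; ring. Qed.

(** If both images lie on one side of the edge, [edge] is the mean of their sides; if they are
    separated, the mean is 0 and [cross] gives the value. The other terms repair the cases where
    some sign is 0. *)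
Lemma edge_decomp (al be ga de p : int) : 0 < p -> (forall x : int, x * x <> p) -> al * de - be * ga = p ->
  2 * edge al be ga de = sgz al * sgz ga + sgz be * sgz de + 2 * cross al be ga de
   + ((be == 0)%:Z * (sgz al * sgz ga) + (ga == 0)%:Z * (sgz be * sgz de))
   + ((al == 0)%:Z * sgz (`|be| - `|ga|) * (sgz be * sgz de)
     + (de == 0)%:Z * sgz (`|ga| - `|be|) * (sgz al * sgz ga)).
Proof.
move=> p0 psq hp.
have hs := det_gt0_signs _ _ _ _ _ p0 hp.
have ht : (al = 0 \/ de = 0) -> be <> ga /\ be <> - ga.
  by move=> h; split=> h2; apply: (psq ga); case: h => h; move: hp; rewrite h h2 ?mul0r ?mulr0; nia.
clear hp; rewrite /edge /cross.
case: (sgzP al) hs ht => hal; case: (sgzP be) => hbe; case: (sgzP ga) => hga; case: (sgzP de) => hde hs ht;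
  try (by exfalso; clear -hs hal hbe hga hde; lia); subst => /=.
all: do ?[case: eqP => ?]; do ?[case: ifP => he]; try (by exfalso; lia); try lia.
Qed.

Lemma edge_decompM (p : int) M x y : 0 < p -> (forall x : int, x * x <> p) -> wedge x y = -1 -> mdet M = p ->
  2 * edgeM M x y = side x y (mact M x) + side x y (mact M y) + 2 * crossM M x y
   + (adj1 M x y + adj2 M x y) + (fix1 M x y + fix2 M x y).
Proof.
move=> p0 psq h hd; rewrite /edgeM (@edge_decomp _ _ _ _ p) //; last first.
  rewrite -hd; transitivity (wedge x y * wedge x y * mdet M); last by rewrite h; ring.
  by case: M {hd} => [[[a b] c] d]; munf; ring.
have e z t : sgz (wedge z t) = - sgz (wedge t z) by rewrite wedgeC sgzN.
rewrite /adj1 /adj2 /fix1 /fix2 /crossM /side !(e _ x) !(e _ y); ring.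
Qed.

(* Representatives of the cusps of the polygon in cyclic order, adjacent ones having wedge -1: a
   quadrilateral for k = 2, a hexagon for k = 3.  The rotation [rot_poly] moves each vertex two steps on. *)
Fixpoint vtx (k : nat) (l : nat) : vec :=
  match l with
  | 0 => (0, 1)
  | 1 => (1, k%:Z)
  | (l'.+1 as l1).+1 => vlin (if odd l1 then 1 else k%:Z) (vtx k l1) (vtx k l')
  end.
(** Geometrically, the number of triangles of the triangulated polygon that meet at vertex l. *)
Definition wt (k l : nat) : int := if odd l then 1 else k%:Z.
Definition rot_poly (k : nat) : mat := (-1, 1, - k%:Z, k%:Z - 1).
Definition rot_poly_inv (k : nat) : mat := (k%:Z - 1, -1, k%:Z, -1).

Lemma vtxSS k l : vtx k l.+2 = vlin (wt k l.+1) (vtx k l.+1) (vtx k l).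
Proof. by []. Qed.

Lemma wtSS k l : wt k l.+2 = wt k l.
Proof. by rewrite /wt /= negbK. Qed.

Lemma nat_step2_ind (P : nat -> Prop) : P 0%N -> P 1%N -> (forall n, P n -> P n.+1 -> P n.+2) -> forall n, P n.
Proof.
move=> h0 h1 hS n; suff: P n /\ P n.+1 by case.
by elim: n => [|n [a b]]; split=> //; apply: hS.
Qed.

Lemma wedge_vtx k l : wedge (vtx k l) (vtx k l.+1) = -1.
Proof.
elim: l => [|l IH]; first by rewrite /wedge /=; ring.
by rewrite vtxSS -IH; munf; ring.
Qed.

Lemma rot_poly_vtx k l : mact (rot_poly k) (vtx k l) = vtx k l.+2.
Proof.
elim/nat_step2_ind: l => [||l h0 h1].
- by rewrite /=; munf; congr (_, _); ring.
- by rewrite /=; munf; congr (_, _); ring.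
rewrite [RHS]vtxSS wtSS -h1 -[in RHS]h0 vtxSS; munf; congr (_, _); ring.
Qed.

Lemma vtx_per k l : (k == 2)%N || (k == 3)%N -> vtx k (l + k.*2) = vopp (vtx k l).
Proof.
move=> hk; elim/nat_step2_ind: l => [||l h0 h1].
- by case/orP: hk => /eqP ->.
- by case/orP: hk => /eqP ->.
rewrite !addSn vtxSS -addSn h0 h1 vtxSS.
have -> : wt k (l.+1 + k.*2) = wt k l.+1 by rewrite /wt oddD odd_double addbF.
munf; congr (_, _); ring.
Qed.

Definition vec_le (C : int) (x : vec) := (`|x.1| <= C) && (`|x.2| <= C).

Lemma vtx_small k l : (k == 2)%N || (k == 3)%N -> vec_le 4 (vtx k l).
Proof.
move=> hk; have h m : vec_le 4 (vtx k (m + k.*2)) = vec_le 4 (vtx k m).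
  by rewrite vtx_per // /vec_le /= !normrN.
suff: forall n l, (l < n)%N -> vec_le 4 (vtx k l) by move/(_ l.+1 l); apply.
elim=> // n IH {}l; rewrite ltnS leq_eqVlt => /orP[/eqP ->|]; last exact: IH.
case: (ltnP n k.*2) => hn.
  move: hn; case/orP: (hk) => /eqP ->.
    by do 4 (case: n IH => [//|n IH]).
  by do 6 (case: n IH => [//|n IH]).
rewrite -(subnK hn) h; apply: IH; case/orP: hk hn => /eqP -> ; lia.
Qed.

Lemma sideN x y z : side x y (vopp z) = side x y z.
Proof.
have e t : wedge (vopp z) t = - wedge z t by munf; ring.
by rewrite /side !e !sgzN mulrNN.
Qed.

Lemma sideNN x y z : side (vopp x) (vopp y) z = side x y z.
Proof.
have e t : wedge z (vopp t) = - wedge z t by munf; ring.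
by rewrite /side !e !sgzN mulrNN.
Qed.

Lemma mact_opp M x : mact M (vopp x) = vopp (mact M x).
Proof. munf; congr (_, _); ring. Qed.

(** A cusp that is not a vertex lies beyond exactly one edge, which gives one value -1 among values
    +1. At a vertex the two adjacent edges give 0 and all others +1. *)
Lemma sum_side k z : (k == 2)%N || (k == 3)%N -> z != (0, 0) ->
  \sum_(l < k.*2) side (vtx k l) (vtx k l.+1) z = k.*2%:Z - 2.
Proof.
case: z => z t hk hz.
have {}hz : ~ (z = 0 /\ t = 0) by move=> [a b]; rewrite a b eqxx in hz.
rewrite -(big_mkord xpredT (fun l => side (vtx k l) (vtx k l.+1) (z, t))).
case/orP: hk => /eqP ->; rewrite /index_iota [iota _ _]/= !big_cons big_nil /side addr0.
  have E0 : wedge (z, t) (vtx 2 0) = z by rewrite /=; munf; ring.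
  have E1 : wedge (z, t) (vtx 2 1) = (2 * z - t) by rewrite /=; munf; ring.
  have E2 : wedge (z, t) (vtx 2 2) = (z - t) by rewrite /=; munf; ring.
  have E3 : wedge (z, t) (vtx 2 3) = (- t) by rewrite /=; munf; ring.
  have E4 : wedge (z, t) (vtx 2 4) = (- z) by rewrite /=; munf; ring.
  rewrite !(E0, E1, E2, E3, E4) !sgzN.
  case: (sgzP z) => ?; case: (sgzP t) => ?; try (by exfalso; lia);
  case: (sgzP (2 * z - t)) => ?; try (by exfalso; lia); case: (sgzP (z - t)) => ?; by lia.
  have E0 : wedge (z, t) (vtx 3 0) = z by rewrite /=; munf; ring.
  have E1 : wedge (z, t) (vtx 3 1) = (3 * z - t) by rewrite /=; munf; ring.
  have E2 : wedge (z, t) (vtx 3 2) = (2 * z - t) by rewrite /=; munf; ring.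
  have E3 : wedge (z, t) (vtx 3 3) = (3 * z - 2 * t) by rewrite /=; munf; ring.
  have E4 : wedge (z, t) (vtx 3 4) = (z - t) by rewrite /=; munf; ring.
  have E5 : wedge (z, t) (vtx 3 5) = (- t) by rewrite /=; munf; ring.
  have E6 : wedge (z, t) (vtx 3 6) = (- z) by rewrite /=; munf; ring.
rewrite !(E0, E1, E2, E3, E4, E5, E6) !sgzN.
case: (sgzP z) => ?; case: (sgzP t) => ?; try (by exfalso; lia);
case: (sgzP (2 * z - t)) => ?; try (by exfalso; lia); case: (sgzP (z - t)) => ?; try (by exfalso; lia);
case: (sgzP (3 * z - t)) => ?; try (by exfalso; lia); case: (sgzP (3 * z - 2 * t)) => ?; by lia.
Qed.

#[global] Arguments vtx : simpl never.

(** * Sums over the matrices in a ball *)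

Definition sym_range (B : nat) : seq int := [seq i%:Z - B%:Z | i <- iota 0 B.*2.+1].

Lemma mem_sym_range B x : (x \in sym_range B) = (`|x| <= B%:Z).
Proof.
apply/mapP/idP => [[i]|h]; first by rewrite mem_iota => h ->; lia.
exists (absz (x + B%:Z)); rewrite ?mem_iota; lia.
Qed.

Lemma uniq_sym_range B : uniq (sym_range B).
Proof. by rewrite map_inj_uniq ?iota_uniq // => i j; lia. Qed.

Definition mat_box B : seq mat :=
  [seq (x.1, x.2, y.1, y.2) | x <- [seq (a, b) | a <- sym_range B, b <- sym_range B],
                              y <- [seq (a, b) | a <- sym_range B, b <- sym_range B]].

Lemma uniq_mat_box B : uniq (mat_box B).
Proof.
have u : uniq [seq (a, b) | a <- sym_range B, b <- sym_range B].
  by apply: allpairs_uniq; rewrite ?uniq_sym_range // => -[a b] [c d] _ _ [-> ->].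
by apply: allpairs_uniq => // -[[a b] [c d]] [[a' b'] [c' d']] _ _ [-> -> -> ->].
Qed.

Lemma mem_mat_box B M : (M \in mat_box B) =
  [&& `|M11 M| <= B%:Z, `|M12 M| <= B%:Z, `|M21 M| <= B%:Z & `|M22 M| <= B%:Z].
Proof.
case: M => [[[a b] c] d]; rewrite /M11 /M12 /M21 /M22 /=.
have h x y : ((x, y) \in [seq (a, b) | a <- sym_range B, b <- sym_range B]) = (`|x| <= B%:Z) && (`|y| <= B%:Z).
  rewrite -!mem_sym_range; apply/idP/andP => [/allpairsP[[u v] /= [h1 h2 [-> ->]]] //|[h1 h2]].
  by apply/allpairsP; exists (x, y).
apply/idP/idP => [/allpairsP[[[x1 x2] [y1 y2]] /=]|].
  by rewrite !h => -[/andP[h1 h2] /andP[h3 h4] [-> -> -> ->]]; rewrite h1 h2 h3 h4.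
by move=> /and4P[h1 h2 h3 h4]; apply/allpairsP; exists ((a, b), (c, d)); rewrite /= !h h1 h2 h3 h4.
Qed.

(** Measuring M between all pairs of vertices, rather than by its entries, makes the set stable
    under right multiplication by the rotation of the polygon. *)
Definition ball (k B : nat) (M : mat) : bool :=
  all (fun i => all (fun j => `|wedge (vtx k i) (mact M (vtx k j))| <= B%:Z) (iota 0 k.*2)) (iota 0 k.*2).
Definition sols (k : nat) (p : int) (E : pred mat) (B : nat) : seq mat :=
  [seq M <- mat_box B | [&& mdet M == p, E M & ball k B M]].

Lemma uniq_sols k p E B : uniq (sols k p E B).
Proof. by rewrite filter_uniq ?uniq_mat_box. Qed.

Lemma vtx_mod k i : (k == 2)%N || (k == 3)%N -> exists2 j, (j < k.*2)%N & vtx k i = vtx k j \/ vtx k i = vopp (vtx k j).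
Proof.
move=> hk; have k0 : (0 < k.*2)%N by lia.
suff: forall n i, (i < n)%N -> exists2 j, (j < k.*2)%N & vtx k i = vtx k j \/ vtx k i = vopp (vtx k j).
  by move/(_ i.+1 i); apply.
elim=> // n IH {}i; rewrite ltnS leq_eqVlt => /orP[/eqP ->|]; last exact: IH.
case: (ltnP n k.*2) => hn; first by exists n => //; left.
rewrite -(subnK hn) vtx_per //; have [|j hj e] := IH (n - k.*2)%N; first lia.
exists j => //; case: e => ->; [by right | left].
by case: (vtx k j) => a b; rewrite /vopp /= !opprK.
Qed.

Lemma wedgeNl x y : wedge (vopp x) y = - wedge x y. Proof. munf; ring. Qed.

Lemma wedgeNr x y : wedge x (vopp y) = - wedge x y. Proof. munf; ring. Qed.

Lemma ballP k B M : (k == 2)%N || (k == 3)%N ->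
  reflect (forall i j, `|wedge (vtx k i) (mact M (vtx k j))| <= B%:Z) (ball k B M).
Proof.
move=> hk; apply: (iffP allP) => [h i j|h i _]; last by apply/allP=> j _; apply: h.
have [i' hi ei] := vtx_mod i hk; have [j' hj ej] := vtx_mod j hk.
have /allP/(_ j') := h i' ltac:(by rewrite mem_iota); rewrite mem_iota => /(_ hj).
by case: ei => ->; case: ej => ->; rewrite ?mact_opp ?wedgeNl ?wedgeNr ?normrN.
Qed.

(** Both (0, 1) and (1, 0) are vertices, so the ball conditions bound all four entries and the ball
    lies inside the box. *)
Lemma mem_sols k p E B M : (k == 2)%N || (k == 3)%N ->
  (M \in sols k p E B) = [&& mdet M == p, E M & ball k B M].
Proof.
move=> hk; rewrite mem_filter; case: (boolP [&& _, _ & _]) => //= /and3P[_ _ /ballP h].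
have {}h := h hk.
have [j ej] : exists j, vtx k j = (1, 0) by exists k.*2.-1; case/orP: hk => /eqP ->.
have := h j j; have := h j 0%N; have := h 0%N j; have := h 0%N 0%N; rewrite ej -[vtx k 0]/((0, 1) : vec) mem_mat_box.
case: M {h} => [[[a b] c] d]; munf; lia.
Qed.

Lemma sum_rot_poly k p E B (F : mat -> int) : (k == 2)%N || (k == 3)%N ->
  (forall M, E (mmul M (rot_poly k)) = E M) ->
  \sum_(M <- sols k p E B) F (mmul M (rot_poly k)) = \sum_(M <- sols k p E B) F M.
Proof.
move=> hk hE.
have k1 M : mmul (mmul M (rot_poly k)) (rot_poly_inv k) = M.
  by case: M => [[[a b] c] d]; rewrite /rot_poly /rot_poly_inv; munf; congr (_, _, _, _); ring.
have k2 M : mmul (mmul M (rot_poly_inv k)) (rot_poly k) = M.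
  by case: M => [[[a b] c] d]; rewrite /rot_poly /rot_poly_inv; munf; congr (_, _, _, _); ring.
have d1 M : mdet (mmul M (rot_poly k)) = mdet M by rewrite mdet_mul /rot_poly; munf; ring.
have d2 M : mdet (mmul M (rot_poly_inv k)) = mdet M by rewrite mdet_mul /rot_poly_inv; munf; ring.
have b1 M : ball k B (mmul M (rot_poly k)) = ball k B M.
  apply/(ballP _ _ hk)/(ballP _ _ hk) => h i j; last by rewrite mact_mul rot_poly_vtx.
  (* The rotation takes vertex j + 2k - 2 to vertex j + 2k, which is vertex j up to sign. *)
  have := h i (j + k.*2.-2)%N; rewrite mact_mul rot_poly_vtx.
  have -> : (j + k.*2.-2).+2 = (j + k.*2)%N by lia.
  by rewrite vtx_per // mact_opp wedgeNr normrN.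
apply: (sum_reindex (f := fun M => mmul M (rot_poly k)) (g := fun M => mmul M (rot_poly_inv k))); rewrite ?uniq_sols //.
  by move=> M h _; split=> //; move: h; rewrite !mem_sols // d1 hE b1.
have e2 M : E (mmul M (rot_poly_inv k)) = E M by rewrite -hE k2.
have b2 M : ball k B (mmul M (rot_poly_inv k)) = ball k B M by rewrite -b1 k2.
by move=> M h _; rewrite k2; split=> //; move: h; rewrite !mem_sols // d2 e2 b2.
Qed.

Lemma mact_neq0 M x : mdet M != 0 -> x != (0, 0) -> mact M x != (0, 0).
Proof.
case: M x => [[[a b] c] d] [z t]; munf => h h2; apply: contra_neq h2 => -[h3 h4].
have e1 : (a * d - b * c) * z = 0 by transitivity (d * (a * z + b * t) - b * (c * z + d * t)); [ring | rewrite h3 h4; ring].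
have e2 : (a * d - b * c) * t = 0 by transitivity (a * (c * z + d * t) - c * (a * z + b * t)); [ring | rewrite h3 h4; ring].
by move/eqP: e1; move/eqP: e2; rewrite !mulf_eq0 (negPf h) /= => /eqP -> /eqP ->.
Qed.

Lemma vtx_neq0 k l : vtx k l != (0, 0).
Proof.
apply/eqP => h; have := wedge_vtx k l; rewrite h; munf; lia.
Qed.

Lemma sum_pairs (g : nat -> int) n : \sum_(s < n) (g s.*2 + g s.*2.+1) = \sum_(j < n.*2) g j.
Proof.
elim: n => [|n IH]; first by rewrite !big_ord0.
by rewrite doubleS !big_ord_recr /= IH -addrA.
Qed.

(** Averaging over the k rotations replaces the images of the two ends of an edge by the images of
    all 2k vertices. For each such image [sum_side] evaluates the sum over the edges. *)
Lemma sum_sides k p E B : (k == 2)%N || (k == 3)%N -> p != 0 ->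
  (forall M, E (mmul M (rot_poly k)) = E M) ->
  \sum_(M <- sols k p E B) \sum_(l < k.*2)
     (side (vtx k l) (vtx k l.+1) (mact M (vtx k l)) + side (vtx k l) (vtx k l.+1) (mact M (vtx k l.+1)))
  = \sum_(M <- sols k p E B) 2 * (k.*2%:Z - 2).
Proof.
move=> hk p0 hE.
pose T s := \sum_(M <- sols k p E B) \sum_(l < k.*2)
     (side (vtx k l) (vtx k l.+1) (mact M (vtx k (l + s.*2))) + side (vtx k l) (vtx k l.+1) (mact M (vtx k (l + s.*2.+1)))).
have hT s : T s = T 0%N.
  elim: s => // s <-; rewrite -[RHS](sum_rot_poly _ _ _ hk hE); apply: eq_bigr => M _.
  by apply: eq_bigr => l _; rewrite !mact_mul !rot_poly_vtx doubleS !addnS.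
have -> : \sum_(M <- sols k p E B) \sum_(l < k.*2)
     (side (vtx k l) (vtx k l.+1) (mact M (vtx k l)) + side (vtx k l) (vtx k l.+1) (mact M (vtx k l.+1))) = T 0%N.
  by apply: eq_bigr => M _; apply: eq_bigr => l _; rewrite addn0 addn1.
have h1 : \sum_(s < k) T s = k%:Z * T 0%N.
  by rewrite (eq_bigr (fun=> T 0%N)) // sumr_const card_ord -mulr_natl natz.
have h2 : \sum_(s < k) T s = \sum_(M <- sols k p E B) k%:Z * (2 * (k.*2%:Z - 2)).
  rewrite /T exchange_big /=; apply: eq_big_seq => M; rewrite mem_sols // => /and3P[/eqP hd _ _].
  rewrite exchange_big /=.
  transitivity (\sum_(l < k.*2) \sum_(j < k.*2) side (vtx k l) (vtx k l.+1) (mact M (vtx k j))).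
    apply: eq_bigr => l _.
    rewrite -(@sum_periodic k.*2 l (fun j => side (vtx k l) (vtx k l.+1) (mact M (vtx k j)))); last first.
      by move=> j; rewrite vtx_per // mact_opp sideN.
    by rewrite -(sum_pairs (fun j => side (vtx k l) (vtx k l.+1) (mact M (vtx k (l + j))))).
  rewrite exchange_big /= (eq_bigr (fun=> k.*2%:Z - 2)) => [|j _]; last first.
    by rewrite sum_side // mact_neq0 ?vtx_neq0 ?hd.
  rewrite sumr_const card_ord -mulr_natl natz; lia.
have : k%:Z * T 0%N = k%:Z * \sum_(M <- sols k p E B) 2 * (k.*2%:Z - 2) by rewrite -h1 h2 mulr_sumr.
by apply: mulfI; lia.
Qed.

Lemma dot_bound (A B a b c d : int) : `|a| <= A -> `|b| <= B -> `|c| <= A -> `|d| <= B ->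
  `|a * b + c * d| <= 2 * A * B.
Proof.
move=> ha hb hc hd; apply: (le_trans (ler_normD _ _)); rewrite !normrM.
have -> : 2 * A * B = A * B + A * B by ring.
by apply: lerD; apply: ler_pM.
Qed.

(* 4096 = (2 * 4) ^ 4: vertices have entries at most 4, and [ball_frame] nests four dot products with them.
   Locked to keep unification from unfolding the numeral. *)
Definition fits (R B : nat) : bool := locked (4096 * R <= B)%N.

Lemma fitsE R B : fits R B = (4096 * R <= B)%N.
Proof. by rewrite /fits -lock. Qed.

Lemma fits_le R R' B : (R' <= R)%N -> fits R B -> fits R' B.
Proof. rewrite !fitsE; lia. Qed.

Lemma ball_frame k i0 j0 B R N : (k == 2)%N || (k == 3)%N -> N \in mat_box R -> fits R B ->
  ball k B (frame (vtx k i0) (vtx k j0) N).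
Proof.
move=> hk; rewrite mem_mat_box => /and4P[h1 h2 h3 h4]; rewrite fitsE => hB; apply/ballP => // i j.
have /andP[] := vtx_small i hk; have /andP[] := vtx_small j hk.
have /andP[] := vtx_small i0 hk; have /andP[] := vtx_small j0 hk.
move: (vtx k i) (vtx k j) (vtx k i0) (vtx k j0) => [i1 i2] [j1 j2] [x1 x2] [y1 y2].
rewrite /frame; munf => hy1 hy2 hx1 hx2 hj1 hj2 hi1 hi2.
have s1 (u v n m : int) : `|u| <= 4 -> `|v| <= 4 -> `|n| <= R%:Z -> `|m| <= R%:Z -> `|u * n + v * m| <= 8 * R%:Z.
  by move=> hu hv hn hm; (have -> : 8 * R%:Z = 2 * 4 * R%:Z by ring); apply: dot_bound.
have s2 (u v n m : int) : `|u| <= 4 -> `|v| <= 4 -> `|n| <= 8 * R%:Z -> `|m| <= 8 * R%:Z -> `|n * u + m * v| <= 64 * R%:Z.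
  by move=> hu hv hn hm; (have -> : 64 * R%:Z = 2 * (8 * R%:Z) * 4 by ring); apply: dot_bound.
have s3 (u v n m : int) : `|u| <= 4 -> `|v| <= 4 -> `|n| <= 64 * R%:Z -> `|m| <= 64 * R%:Z -> `|n * u + m * v| <= 512 * R%:Z.
  by move=> hu hv hn hm; (have -> : 512 * R%:Z = 2 * (64 * R%:Z) * 4 by ring); apply: dot_bound.
have s4 (u v n m : int) : `|u| <= 4 -> `|v| <= 4 -> `|n| <= 512 * R%:Z -> `|m| <= 512 * R%:Z -> `|u * n - v * m| <= 4096 * R%:Z.
  move=> hu hv hn hm; have -> : 4096 * R%:Z = 2 * 4 * (512 * R%:Z) by ring.
  by rewrite -mulNr; apply: dot_bound; rewrite ?normrN.
apply: (@le_trans _ _ (4096 * R%:Z)); last by lia.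
apply: s4 => //; apply: s3 => //; apply: s2; rewrite ?normrN //; apply: s1 => //.
Qed.

(** * Cancellation of the crossing terms *)

Definition mswap (N : mat) : mat := (M22 N, M12 N, M21 N, M11 N).

Lemma crossM_unframe M x y : let N := unframe x y M in
  crossM M x y = cross (- M21 N) (- M22 N) (M11 N) (M12 N).
Proof. by rewrite /crossM /unframe /M11 /M12 /M21 /M22 /= !opprK. Qed.

(** On the support of [cross] both [al * de] and [- be * ga] are positive integers, and their sum is
    p. *)
Lemma cross_bound al be ga de p : al * de - be * ga = p -> cross al be ga de != 0 ->
  [/\ `|al| <= p, `|be| <= p, `|ga| <= p & `|de| <= p].
Proof.
move=> h; rewrite /cross; case: ifP => // /andP[c1 c2] _.
by case/orP: c1 => /andP[h1 h2]; case/orP: c2 => /andP[h3 h4]; split; nia.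
Qed.

Lemma cross_swap al be ga de : cross al (- ga) (- be) de = - cross al be ga de.
Proof.
rewrite /cross.
have -> : - ga + - be = - (be + ga) by ring.
rewrite sgzN !oppr_gt0 !oppr_lt0; case: ifP => h1; case: ifP => h2; lia.
Qed.

Lemma unframe_mdet M x y : wedge x y = -1 -> mdet (unframe x y M) = mdet M.
Proof. by move=> h; rewrite -{2}(unframeK M h) frame_mdet. Qed.

(** Exchanging the diagonal entries in the frame of the edge keeps [al], [de] and the determinant
    and negates [be + ga]. This is a sign-reversing involution, and by [cross_bound] it does not
    leave the ball. *)
Lemma sum_crossM k l (P : nat) E B : (k == 2)%N || (k == 3)%N ->
  (forall M, mdet M = P%:Z -> E (frame (vtx k l) (vtx k l.+1) (mswap (unframe (vtx k l) (vtx k l.+1) M))) = E M) ->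
  fits P B ->
  \sum_(M <- sols k P%:Z E B) crossM M (vtx k l) (vtx k l.+1) = 0.
Proof.
move=> hk hE hB; have hv := wedge_vtx k l.
set x := vtx k l in hE hv *; set y := vtx k l.+1 in hE hv *.
apply: (sum_sign_reversing (f := fun M => frame x y (mswap (unframe x y M)))); first exact: uniq_sols.
move=> M; rewrite !mem_sols // => /and3P[/eqP hd hEM _].
rewrite !crossM_unframe frameK //; move: (unframe_mdet M hv) (unframeK M hv).
case: (unframe x y M) => [[[a b] c] d]; rewrite hd /mswap /M11 /M12 /M21 /M22 /= => hd2 e nz.
have hd3 : - c * b - - d * a = P%:Z by rewrite -hd2; munf; ring.
have hd4 : - c * b - - a * d = P%:Z by rewrite -hd2; munf; ring.
have [b1 b2 b3 b4] := cross_bound hd3 nz.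
split=> //; last by rewrite -{1}(opprK d) cross_swap.
have q : - b <= P%:Z by rewrite normrN in b1; lia.
rewrite frame_mdet //; apply/and3P; split.
- by rewrite -hd2; munf; apply/eqP; ring.
- by have := hE (frame x y (a, b, c, d)); rewrite frameK // e hEM /mswap => ->.
apply: (@ball_frame _ _ _ _ P) => //.
by rewrite mem_mat_box /M11 /M12 /M21 /M22 /=; apply/and4P; split; rewrite // -normrN.
Qed.

(** * Signed counts of integers in an interval *)

Lemma sum_sym_rangeN R (F : int -> int) : \sum_(t <- sym_range R) F (- t) = \sum_(t <- sym_range R) F t.
Proof.
apply: (sum_reindex (f := -%R) (g := -%R)); rewrite ?uniq_sym_range // => t; rewrite !mem_sym_range normrN ?opprK => h _; by [].
Qed.

Lemma sum_sgz R : \sum_(t <- sym_range R) sgz t = 0.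
Proof.
suff : \sum_(t <- sym_range R) sgz t = - \sum_(t <- sym_range R) sgz t by move: (\sum_(t <- _) _) => S; lia.
by rewrite -{1}(sum_sym_rangeN R) -sumrN; apply: eq_bigr => t _; rewrite sgzN.
Qed.

Lemma sum_delta R (a : int) : `|a| <= R%:Z -> \sum_(t <- sym_range R) (t == a)%:Z = 1.
Proof.
move=> h; rewrite (bigD1_seq a) ?mem_sym_range ?uniq_sym_range //= eqxx big1 ?addr0 // => t /negPf -> //.
Qed.

Lemma sum_sgz_shift R (q : int) : `|q| <= R%:Z -> \sum_(t <- sym_range R) sgz (q - t) = 2 * q.
Proof.
have key (n : nat) : (n <= R)%N -> \sum_(t <- sym_range R) sgz (n%:Z - t) = 2 * n%:Z.
  elim: n => [_|n IH hn].
    rewrite (eq_bigr (fun t => - sgz t)) => [|t _]; last by rewrite sub0r sgzN.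
    by rewrite sumrN sum_sgz.
  transitivity (\sum_(t <- sym_range R) (sgz (n%:Z - t) + ((t == n%:Z)%:Z + (t == n.+1%:Z)%:Z))).
    by apply: eq_bigr => t _; case: (t =P _) => ?; case: (t =P _) => ?; lia.
  rewrite !big_split /= IH ?sum_delta; lia.
case: q => n h; first by rewrite key //; lia.
rewrite NegzE -sum_sym_rangeN (eq_bigr (fun t => - sgz (n.+1%:Z - t))) => [|t _]; last first.
  by rewrite -sgzN; congr sgz; ring.
by rewrite sumrN key; lia.
Qed.

Lemma sgz_muls (e x : int) : 0 < e -> sgz (e * x) = sgz x.
Proof. by move=> h; rewrite sgzM gtr0_sgz // mul1r. Qed.

(** The summand is twice the sign of n for multiples of e strictly between 0 and n, once that sign
    at the two ends, and 0 outside, so the sum is 2 n / e. *)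
Lemma sum_window R (e n : int) : 0 < e -> (e %| n)%Z -> `|n| <= R%:Z ->
  e * \sum_(t <- sym_range R) (sgz (e * t) + sgz (n - e * t)) = 2 * n.
Proof.
move=> he /dvdzP[q ->] hR.
rewrite (eq_bigr (fun t => sgz t + sgz (q - t))) => [|t _]; last first.
  by rewrite sgz_muls //; congr (_ + _); rewrite -(sgz_muls (q - t) he); congr sgz; ring.
rewrite big_split /= sum_sgz add0r sum_sgz_shift; [ring | nia].
Qed.

(** * Matrices with a zero entry in the frame of an edge *)

Lemma factor_prime (P : nat) (d1 d2 : int) : prime P -> d1 * d2 = P%:Z ->
  (d1, d2) \in [:: (1, P%:Z); (P%:Z, 1); (-1, - P%:Z); (- P%:Z, -1)].
Proof.
move=> hP h; have P1 := prime_gt1 hP.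
have e : (absz d1 * absz d2)%N = P by rewrite -abszM h.
have /(primeP hP).2 : (absz d1 %| P)%N by rewrite -e dvdn_mulr.
rewrite !inE /eq_op /=; case/orP => /eqP hd.
  have : d1 = 1 \/ d1 = -1 by lia.
  by case=> ?; subst d1; lia.
have : d1 = P%:Z \/ d1 = - P%:Z by lia.
by case=> ?; subst d1; nia.
Qed.

Definition signed_divs (P : nat) : seq (int * int) := [:: (1, P%:Z); (P%:Z, 1); (-1, - P%:Z); (- P%:Z, -1)].

Lemma uniq_signed_divs P : (1 < P)%N -> uniq (signed_divs P).
Proof.
move=> h; rewrite /signed_divs /= !inE !negb_or /eq_op /=; lia.
Qed.

Lemma signed_divs_prod P d : d \in signed_divs P -> d.1 * d.2 = P%:Z.
Proof. rewrite !inE => /or4P[]/eqP -> /=; ring. Qed.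

(* F is supported on matrices with a zero entry in the basis x, y; they are given by a factorization d of P and
   one free entry X, which E restricts to the multiples of e. *)
Lemma sum_family k l (P : nat) E B R (e : int) (F : mat -> int) (fm : int * int -> int -> mat)
   (rd : mat -> (int * int) * int) (G : int * int -> int -> int) :
  (k == 2)%N || (k == 3)%N -> prime P -> fits R B -> 0 < e ->
  let x := vtx k l in let y := vtx k l.+1 in
  (forall d X, rd (fm d X) = (d, X)) ->
  (forall d X, mdet (fm d X) = d.1 * d.2) ->
  (forall N, F (frame x y N) != 0 -> N = fm (rd N).1 (rd N).2) ->
  (forall d X, F (frame x y (fm d X)) = G d X) ->
  (forall d X, d.1 * d.2 = P%:Z -> E (frame x y (fm d X)) = (e %| X)%Z) ->
  (forall d X, d \in signed_divs P -> G d X != 0 -> fm d X \in mat_box R /\ `|X| <= R%:Z) ->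
  \sum_(M <- sols k P%:Z E B) F M = \sum_(d <- signed_divs P) \sum_(t <- sym_range R) G d (e * t).
Proof.
move=> hk hP hB he x y hrd hdt hF hG hE hb; have hv := wedge_vtx k l; rewrite -/x -/y in hv.
pose S2 := [seq (d, t) | d <- signed_divs P, t <- sym_range R].
have memS2 d t : ((d, t) \in S2) = (d \in signed_divs P) && (`|t| <= R%:Z).
  rewrite -mem_sym_range; apply/allpairsPdep/andP => [[u [v [hu hv' [-> ->]]]] //|[hu hv']].
  by exists d, t.
have uS2 : uniq S2.
  by apply: allpairs_uniq; rewrite ?uniq_signed_divs ?uniq_sym_range ?prime_gt1 // => -[d t] [d' t'] _ _ [-> ->].
transitivity (\sum_(z <- S2) G z.1 (e * z.2)); last by rewrite big_allpairs_dep.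
move: (S2) memS2 uS2 => {}S2 memS2 uS2.
apply: (sum_reindex (f := fun M => ((rd (unframe x y M)).1, ((rd (unframe x y M)).2 %/ e)%Z))
                    (g := fun z => frame x y (fm z.1 (e * z.2)))).
- exact: uniq_sols.
- by [].
- move=> M; rewrite mem_sols // => /and3P[/eqP hd hEM _]; rewrite -(unframeK M hv) => nz.
  have eN := hF _ nz; rewrite frameK //=.
  set d := (rd _).1 in eN *; set X := (rd _).2 in eN *.
  have hdd : d.1 * d.2 = P%:Z by rewrite -(hdt _ X) -eN unframe_mdet.
  have hX : (e %| X)%Z by rewrite -(hE d X hdd) -eN unframeK.
  have eX : e * (X %/ e)%Z = X by rewrite mulrC divzK.
  have hdf : d \in signed_divs P.
    by have := factor_prime hP hdd; rewrite /signed_divs; case: (d).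
  rewrite eX -eN; split=> //; last by rewrite eN hG.
  have nz' : G d X != 0 by rewrite -hG -eN.
  have [_ hX2] := hb d X hdf nz'.
  by rewrite memS2 hdf; nia.
case=> d t; rewrite memS2 => /andP[hd ht] /= nz.
have hp := signed_divs_prod hd; have [hm _] := hb _ _ hd nz.
rewrite frameK // hrd /=; split; [|exact: hG | by rewrite mulKz // gt_eqF].
rewrite mem_sols // frame_mdet // hdt hp eqxx hE // dvdz_mulr ?dvdzz //=.
exact: ball_frame hB.
Qed.

(** * Contributions of the vertices *)

Definition adj_vtx k M l : int := (wedge (vtx k l.+1) (mact M (vtx k l.+2)) == 0)%:Z *
  (side (vtx k l.+1) (vtx k l.+2) (mact M (vtx k l.+1)) + side (vtx k l) (vtx k l.+1) (mact M (vtx k l.+3))).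
Definition fix_vtx k M l : int := fix2 M (vtx k l) (vtx k l.+1) + fix1 M (vtx k l.+1) (vtx k l.+2).

Lemma unframeE x y M : wedge x y = -1 -> [/\ wedge x (mact M x) = - M21 (unframe x y M),
   wedge x (mact M y) = - M22 (unframe x y M), wedge y (mact M x) = M11 (unframe x y M) & wedge y (mact M y) = M12 (unframe x y M)].
Proof. by move=> h; rewrite /unframe /M11 /M12 /M21 /M22 /= !opprK. Qed.

Lemma vtx_pred k l : vtx k l = vlin (wt k l.+1) (vtx k l.+1) (vtx k l.+2).
Proof. rewrite vtxSS; case: (vtx k l) => a b; munf; congr (_, _); ring. Qed.

Lemma adj_vtx_frame k l a b c d : adj_vtx k (frame (vtx k l.+1) (vtx k l.+2) (a, b, c, d)) l =
  (d == 0)%:Z * (sgz c * sgz (- a) + sgz (wt k l.+2 * b - wt k l.+1 * c - a + (wt k l.+1 * wt k l.+2) * d) * sgz (wt k l.+2 * d - c)).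
Proof.
have hv := wedge_vtx k l.+1; set M := frame _ _ _.
have [h1 h2 h3 h4] := unframeE M hv; rewrite frameK // /M11 /M12 /M21 /M22 /= in h1 h2 h3 h4.
have p1 := vtx_pred k l; have p2 := vtxSS k l.+1.
rewrite /adj_vtx h2 oppr_eq0 /side ![wedge (mact M _) _]wedgeC.
set x := vtx k l.+1 in h1 h2 h3 h4 p1 p2 *; set y := vtx k l.+2 in h1 h2 h3 h4 p1 p2 *.
have e1 z v t : wedge (vlin z v t) (mact M (vlin (wt k l.+2) y x)) =
   z * (wt k l.+2) * wedge v (mact M y) - z * wedge v (mact M x) - (wt k l.+2) * wedge t (mact M y) + wedge t (mact M x).
  by case: (M) => [[[m1 m2] m3] m4]; munf; ring.
have e2 v : wedge v (mact M (vlin (wt k l.+2) y x)) = (wt k l.+2) * wedge v (mact M y) - wedge v (mact M x).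
  by case: (M) => [[[m1 m2] m3] m4]; munf; ring.
rewrite p1 p2 e1 e2 h1 h2 h3 h4 opprK.
have -> : - (wt k l.+1 * wt k l.+2 * - d - wt k l.+1 * - c - wt k l.+2 * b + a) =
  wt k l.+2 * b - wt k l.+1 * c - a + wt k l.+1 * wt k l.+2 * d by ring.
have -> : - (wt k l.+2 * - d + c) = wt k l.+2 * d - c by ring.
by [].
Qed.

Lemma fix_vtx_frame k l a b c d : fix_vtx k (frame (vtx k l.+1) (vtx k l.+2) (a, b, c, d)) l =
  (c == 0)%:Z * (sgz (`|d| - `|a|) * sgz d * (sgz (- b) - sgz (wt k l.+1 * (a - d) - b))).
Proof.
have hv := wedge_vtx k l.+1; set M := frame _ _ _.
have [h1 h2 h3 h4] := unframeE M hv; rewrite frameK // /M11 /M12 /M21 /M22 /= in h1 h2 h3 h4.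
rewrite /fix_vtx /fix1 /fix2 h1 h2 h3 /side ![wedge (mact M _) _]wedgeC (vtx_pred k l).
set x := vtx k l.+1 in h1 h2 h3 h4 *; set y := vtx k l.+2 in h1 h2 h3 h4 *.
have e1 v : wedge (vlin (wt k l.+1) x y) (mact M v) = wt k l.+1 * wedge x (mact M v) - wedge y (mact M v).
  by case: (M) => [[[m1 m2] m3] m4]; munf; ring.
have e2 v : wedge v (mact M (vlin (wt k l.+1) x y)) = (wt k l.+1) * wedge v (mact M x) - wedge v (mact M y).
  by case: (M) => [[[m1 m2] m3] m4]; munf; ring.
rewrite !e1 !e2 h1 h2 h3 h4 oppr_eq0; case: (c =P 0) => [->|_]; last by rewrite !mul0r.
have -> : wt k l.+1 * - 0 - - d = d by ring.
have -> : wt k l.+1 * - 0 - a = - a by ring.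
have -> : - (wt k l.+1 * d - (wt k l.+1 * a - b)) = wt k l.+1 * (a - d) - b by ring.
rewrite opprK !normrN (sgzN d); ring.
Qed.

Lemma wt_bounds k l : (k == 2)%N || (k == 3)%N -> 1 <= wt k l <= 3.
Proof. by rewrite /wt; case: odd => // /orP[]/eqP ->. Qed.

Lemma big_signed_divs P (F : int * int -> int) : \sum_(d <- signed_divs P) F d = F (1, P%:Z) + F (P%:Z, 1) + F (-1, - P%:Z) + F (- P%:Z, -1).
Proof. rewrite /signed_divs !big_cons big_nil; ring. Qed.

Lemma signed_divs_ind (P : nat) (Q : int * int -> Prop) :
  Q (1, P%:Z) -> Q (P%:Z, 1) -> Q (-1, - P%:Z) -> Q (- P%:Z, -1) -> forall d, d \in signed_divs P -> Q d.
Proof. by move=> h1 h2 h3 h4 d; rewrite !inE => /or4P[]/eqP ->. Qed.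

Lemma window_bound (s n X : int) : sgz X + sgz (n - X) != 0 -> `|X| <= `|n|.
Proof. lia. Qed.

(** In the frame of the edge the lower right entry is 0 and the off-diagonal entries are d1 and -d2
    with d1 d2 = P. The remaining entry X contributes while it lies between 0 and [n d], and
    [sum_window] counts the admissible X. *)
Lemma sum_adj_vtx k l (P : nat) E B (e : int) :
  (k == 2)%N || (k == 3)%N -> prime P -> fits (6 * P) B -> 0 < e ->
  (forall d1 d2 X, d1 * d2 = P%:Z ->
     E (frame (vtx k l.+1) (vtx k l.+2) (X, d1, - d2, 0)) = (e %| X)%Z) ->
  (e %| wt k l.+2 + wt k l.+1 * P%:Z)%Z -> (e %| wt k l.+2 * P%:Z + wt k l.+1)%Z ->
  e * \sum_(M <- sols k P%:Z E B) adj_vtx k M l = 4 * (wt k l.+1 + wt k l.+2) * (P%:Z + 1).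
Proof.
move=> hk hP hB he hE dv1 dv2; have P1 := prime_gt1 hP.
have /andP[w1 w2] := wt_bounds l.+1 hk; have /andP[w3 w4] := wt_bounds l.+2 hk.
set w := wt k l.+1 in dv1 dv2 w1 w2 *; set w' := wt k l.+2 in dv1 dv2 w3 w4 *.
pose n (d : int * int) := w' * d.1 + w * d.2.
(* The weights are at most 3, so the window has length at most 3 + 3 P, hence at most 6 P. *)
have hn : forall d, d \in signed_divs P -> `|n d| <= (6 * P)%N%:Z by apply: signed_divs_ind => /=; rewrite /n /=; nia.
have hen : forall d, d \in signed_divs P -> (e %| n d)%Z.
  apply: signed_divs_ind; rewrite /n /=.
  - by rewrite mulr1.
  - by rewrite mulr1.
  - by rewrite (_ : w' * -1 + w * - P%:Z = - (w' + w * P%:Z)) ?rpredN //; ring.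
  by rewrite (_ : w' * - P%:Z + w * -1 = - (w' * P%:Z + w)) ?rpredN //; ring.
have hs : forall d, d \in signed_divs P -> sgz d.2 = 1 \/ sgz d.2 = -1 by apply: signed_divs_ind => /=; lia.
transitivity (e * \sum_(d <- signed_divs P) \sum_(t <- sym_range (6 * P)) (sgz d.2 * (sgz (e * t) + sgz (n d - e * t)))).
{ congr (_ * _); apply: (@sum_family k l.+1 P E B (6 * P)%N e (fun M => adj_vtx k M l) (fun d X => (X, d.1, - d.2, 0))
   (fun N => ((M12 N, - M21 N), M11 N)) (fun d X => sgz d.2 * (sgz X + sgz (n d - X)))) => //.
  - by case=> d1 d2 X; rewrite /M12 /M21 /M11 /= opprK.
  - by case=> d1 d2 X; munf; ring.
  - case=> [[[a b] c] d]; rewrite adj_vtx_frame /M12 /M21 /M11 /= opprK.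
    by case: (d =P 0) => [->|]; rewrite ?mul0r ?eqxx.
  - case=> d1 d2 X; rewrite adj_vtx_frame eqxx /= mul1r !sgzN opprK mulr0 addr0.
    have -> : w' * d1 - w * - d2 - X = n (d1, d2) - X by rewrite /n /=; ring.
    by rewrite ?mulr0 ?add0r; ring.
  - by case=> d1 d2 X h; rewrite /= hE.
  move=> d X hd nz; have hX : `|X| <= (6 * P)%N%:Z.
    apply: le_trans (hn d hd); apply: (window_bound d.2); apply: contra_neq nz => ->; ring.
  split=> //; rewrite mem_mat_box /M11 /M12 /M21 /M22 /= hX normr0 /=.
  by move: d hd {nz}; apply: signed_divs_ind => /=; lia. }
rewrite mulr_sumr.
transitivity (\sum_(d <- signed_divs P) sgz d.2 * (2 * n d)).
  apply: eq_big_seq => d hd; rewrite -(sum_window he (hen d hd) (hn d hd)).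
  by rewrite -mulr_sumr; ring.
rewrite big_signed_divs /n /=.
have -> : sgz P%:Z = 1 by lia.
have -> : sgz (- P%:Z) = -1 by lia.
have -> : sgz (-1 : int) = -1 by [].
by rewrite !sgz1; ring.
Qed.

(** Now the lower left entry is 0, the diagonal is a factorization of P, and the window ends at w
    (d1 - d2). The sign of |d2| - |d1| tells a repelling vertex from an attracting one, which makes
    all four factorizations contribute equally. *)
Lemma sum_fix_vtx k l (P : nat) E B (e : int) :
  (k == 2)%N || (k == 3)%N -> prime P -> fits (6 * P) B -> 0 < e ->
  (forall d1 d2 X, d1 * d2 = P%:Z ->
     E (frame (vtx k l.+1) (vtx k l.+2) (d1, X, 0, d2)) = (e %| X)%Z) ->
  (e %| wt k l.+1 * (P%:Z - 1))%Z ->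
  e * \sum_(M <- sols k P%:Z E B) fix_vtx k M l = 8 * wt k l.+1 * (P%:Z - 1).
Proof.
move=> hk hP hB he hE dv; have P1 := prime_gt1 hP.
have /andP[w1 w2] := wt_bounds l.+1 hk.
set w := wt k l.+1 in dv w1 w2 *.
pose n (d : int * int) := w * (d.1 - d.2).
have hn : forall d, d \in signed_divs P -> `|n d| <= (6 * P)%N%:Z by apply: signed_divs_ind => /=; rewrite /n /=; nia.
have hen : forall d, d \in signed_divs P -> (e %| n d)%Z.
  have dv' : (e %| w * (1 - P%:Z))%Z by rewrite -opprB mulrN rpredN.
  by apply: signed_divs_ind; rewrite /n /= ?opprK // addrC.
transitivity (e * \sum_(d <- signed_divs P) \sum_(t <- sym_range (6 * P)) (- (sgz (`|d.2| - `|d.1|) * sgz d.2) * (sgz (e * t) + sgz (n d - e * t)))).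
{ congr (_ * _); apply: (@sum_family k l.+1 P E B (6 * P)%N e (fun M => fix_vtx k M l) (fun d X => (d.1, X, 0, d.2))
   (fun N => ((M11 N, M22 N), M12 N))
   (fun d X => - (sgz (`|d.2| - `|d.1|) * sgz d.2) * (sgz X + sgz (n d - X)))) => //.
  - by case.
  - by case=> d1 d2 X; munf; ring.
  - case=> [[[a b] c] d]; rewrite fix_vtx_frame /M12 /M22 /M11 /=.
    by case: (c =P 0) => [->|]; rewrite ?mul0r ?eqxx.
  - by case=> d1 d2 X; rewrite fix_vtx_frame eqxx /= mul1r !sgzN /n /=; ring.
  - by case=> d1 d2 X h; rewrite /= hE.
  move=> d X hd nz; have hX : `|X| <= (6 * P)%N%:Z.
    apply: le_trans (hn d hd); apply: (window_bound d.2); apply: contra_neq nz => ->; ring.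
  split=> //; rewrite mem_mat_box /M11 /M12 /M21 /M22 /= hX.
  by move: d hd {nz}; apply: signed_divs_ind => /=; lia. }
rewrite mulr_sumr.
transitivity (\sum_(d <- signed_divs P) - (sgz (`|d.2| - `|d.1|) * sgz d.2) * (2 * n d)).
  apply: eq_big_seq => d hd; rewrite -(sum_window he (hen d hd) (hn d hd)).
  by rewrite -mulr_sumr; ring.
rewrite big_signed_divs /n /= !normrN !normr1.
have -> : sgz P%:Z = 1 by lia.
have -> : sgz (- P%:Z) = -1 by lia.
have -> : sgz (`|P%:Z| - 1 : int) = 1 by lia.
have -> : sgz (1 - `|P%:Z| : int) = -1 by lia.
have -> : sgz (-1 : int) = -1 by [].
by rewrite !sgz1; ring.
Qed.

(** * Edge sums reduced to vertex contributions *)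

Lemma prime_nonsquare (P : nat) (x : int) : prime P -> x * x <> P%:Z.
Proof.
move=> hP h; have e : (absz x * absz x)%N = P by rewrite -abszM h.
have P1 := prime_gt1 hP.
have /(primeP hP).2 : (absz x %| P)%N by rewrite -e dvdn_mulr.
by case/orP => /eqP h2; rewrite h2 in e; nia.
Qed.

(** Summing [edge_decompM], the sides cancel against the constant by [sum_sides], the crossing terms
    vanish, and the corrections are regrouped by vertices. *)
Lemma sum_edges k (P : nat) E B : (k == 2)%N || (k == 3)%N -> prime P -> fits (6 * P) B ->
  (forall M, E (mmul M (rot_poly k)) = E M) ->
  (forall l M, mdet M = P%:Z -> E (frame (vtx k l) (vtx k l.+1) (mswap (unframe (vtx k l) (vtx k l.+1) M))) = E M) ->
  2 * \sum_(M <- sols k P%:Z E B) (\sum_(l < k.*2) edgeM M (vtx k l) (vtx k l.+1) - (k.*2%:Z - 2))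
  = \sum_(l < k.*2) \sum_(M <- sols k P%:Z E B) fix_vtx k M l + \sum_(l < k.*2) \sum_(M <- sols k P%:Z E B) adj_vtx k M l.
Proof.
move=> hk hP hB hE1 hE2; have P1 := prime_gt1 hP.
have hB' : fits P B by apply: fits_le hB; lia.
set L := sols _ _ _ _; set m := k.*2.
have pw : 2 * \sum_(M <- L) (\sum_(l < m) edgeM M (vtx k l) (vtx k l.+1) - (m%:Z - 2)) =
  \sum_(M <- L) \sum_(l < m) (side (vtx k l) (vtx k l.+1) (mact M (vtx k l)) + side (vtx k l) (vtx k l.+1) (mact M (vtx k l.+1)))
  + 2 * (\sum_(M <- L) \sum_(l < m) crossM M (vtx k l) (vtx k l.+1))
  + (\sum_(M <- L) \sum_(l < m) adj1 M (vtx k l) (vtx k l.+1) + \sum_(M <- L) \sum_(l < m) adj2 M (vtx k l) (vtx k l.+1))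
  + (\sum_(M <- L) \sum_(l < m) fix1 M (vtx k l) (vtx k l.+1) + \sum_(M <- L) \sum_(l < m) fix2 M (vtx k l) (vtx k l.+1))
  - \sum_(M <- L) 2 * (m%:Z - 2).
  rewrite !mulr_sumr -!big_split /= -sumrB; apply: eq_big_seq => M.
  rewrite mem_sols // => /and3P[/eqP hd _ _].
  rewrite mulrBr !mulr_sumr -!big_split /=; congr (_ - _); apply: eq_bigr => l _.
  by rewrite (@edge_decompM P%:Z) ?wedge_vtx //; [lia | move=> x; apply: prime_nonsquare].
rewrite pw sum_sides //; last by lia.
have -> : \sum_(M <- L) \sum_(l < m) crossM M (vtx k l) (vtx k l.+1) = 0.
  by rewrite exchange_big big1 //= => l _; apply: (sum_crossM hk (hE2 l) hB').
(* After the rotation, [adj2] at the edge from l to l + 1 carries the condition that M takes vertex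
   l + 2 to vertex l + 1, the same as [adj1] at the next edge; together they form [adj_vtx]. *)
have -> : \sum_(M <- L) \sum_(l < m) adj2 M (vtx k l) (vtx k l.+1) =
   \sum_(M <- L) \sum_(l < m) adj2 (mmul M (rot_poly k)) (vtx k l) (vtx k l.+1).
  by rewrite (sum_rot_poly _ _ (fun M => \sum_(l < m) adj2 M (vtx k l) (vtx k l.+1)) hk hE1).
have per1 M : \sum_(l < m) adj1 M (vtx k l) (vtx k l.+1) = \sum_(l < m) adj1 M (vtx k l.+1) (vtx k l.+2).
  rewrite -(@sum_periodic m 1 (fun l => adj1 M (vtx k l) (vtx k l.+1))) // => j.
  by rewrite -addSn !vtx_per // /adj1 !mact_opp wedgeNl wedgeNr opprK sideN sideNN.
have per2 M : \sum_(l < m) fix1 M (vtx k l) (vtx k l.+1) = \sum_(l < m) fix1 M (vtx k l.+1) (vtx k l.+2).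
  rewrite -(@sum_periodic m 1 (fun l => fix1 M (vtx k l) (vtx k l.+1))) // => j.
  by rewrite -addSn !vtx_per // /fix1 !mact_opp !wedgeNl !wedgeNr !opprK sideN sideNN.
rewrite (eq_bigr _ (fun M _ => per1 M)) (eq_bigr _ (fun M _ => per2 M)).
have aux (S A1 A2 F1 F2 : int) : S + 2 * 0 + (A1 + A2) + (F1 + F2) - S = (F1 + F2) + (A1 + A2) by ring.
rewrite aux; transitivity (\sum_(M <- L) \sum_(l < m) (fix_vtx k M l + adj_vtx k M l)); last first.
  by rewrite exchange_big -big_split; apply: eq_bigr => l _; rewrite big_split.
rewrite -!big_split /=; apply: eq_bigr => M _; rewrite -!big_split /=; apply: eq_bigr => l _.
rewrite /fix_vtx /adj_vtx /adj1 /adj2 !mact_mul !rot_poly_vtx; ring.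
Qed.

(** * From edges to ideal triangles *)

(* The Selling parameters of the form x^Nx, from its values at the three cusps of the triangle. *)
Definition hsel_edges (fx fy fz : int) : int := hsel (fz + fx - fy) (fz + fy - fx) (fx + fy - fz).
Definition tri_weight (N : mat) : int := hsel_edges (- M21 N) (M12 N) (M12 N - M11 N + M22 N - M21 N).
Definition mopp (N : mat) : mat := (- M11 N, - M12 N, - M21 N, - M22 N).

Lemma edge_rev al be ga de p : 0 < p -> al * de - be * ga = p ->
  edge de (- ga) (- be) al = - edge al be ga de.
Proof.
move=> p0 hp; have hs := det_gt0_signs _ _ _ _ _ p0 hp; clear hp.
rewrite /edge !normrN !sgzN !oppr_eq0.
have -> : - ga + - be = - (be + ga) by ring.
rewrite sgzN.
case: (sgzP al) hs => hal; case: (sgzP be) => hbe; case: (sgzP ga) => hga; case: (sgzP de) => hde hs;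
  try (by exfalso; clear -hs hal hbe hga hde; lia); subst => /=.
all: do ?[case: eqP => ?]; do ?[case: ifP => ?]; try (by exfalso; lia); try lia.
Qed.

(** Makes a diagonal cancel, since the two triangles that share it traverse it in opposite
    directions. *)
Lemma edgeM_rev M x y p : 0 < p -> mdet M = p -> wedge x y = -1 -> edgeM M y (vopp x) = - edgeM M x y.
Proof.
move=> p0 hd h; rewrite /edgeM mact_opp !wedgeNl !wedgeNr opprK; apply: edge_rev p0 _.
rewrite -hd; transitivity (wedge x y * wedge x y * mdet M); last by rewrite h; ring.
by case: M {hd} => [[[a b] c] d]; munf; ring.
Qed.

Lemma edgeM_NN M x y : edgeM M (vopp x) (vopp y) = edgeM M x y.
Proof. by rewrite /edgeM !mact_opp !wedgeNl !wedgeNr !opprK. Qed.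

(** M and -M have the same fixed point but opposite forms, and only a positive definite form gets a
    nonzero weight when the determinant is not a square. *)
Definition tri_weight_sym (M : mat) (x y : vec) : int :=
  tri_weight (unframe x y M) + tri_weight (mopp (unframe x y M)).

Lemma edgeM_triangle M x y p : 0 < p -> (forall x, x * x <> p) -> mdet M = p -> wedge x y = -1 ->
  edgeM M x y + edgeM M y (vlin 1 y x) + edgeM M (vlin 1 y x) (vopp x) = 1 + tri_weight_sym M x y.
Proof.
move=> p0 psq hd h; move: (unframe_mdet M h) (unframeE M h); rewrite /tri_weight_sym.
have e1 z : wedge (vlin 1 y x) (mact M z) = wedge y (mact M z) - wedge x (mact M z) by munf; ring.
have e2 z : wedge z (mact M (vlin 1 y x)) = wedge z (mact M y) - wedge z (mact M x) by munf; ring.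
case: (unframe x y M) => [[[a b] c] d]; rewrite hd /mdet /M11 /M12 /M21 /M22 /= => hd2 [h1 h2 h3 h4].
rewrite /edgeM !(e1, e2, wedgeNl, wedgeNr, mact_opp) ?(e1, e2) h1 h2 h3 h4.
have hp : (d - c) * (a + c) - c * (b - a + d - c) = p by rewrite -hd2; ring.
(* This is M in the coordinates in which x is (0, 1) and y is (1, 1). *)
have T := edge_triangle (d - c) c (b - a + d - c) (a + c) p p0 psq hp.
apply: (etrans (etrans _ T)).
  congr (edge _ _ _ _ + edge _ _ _ _ + edge _ _ _ _); ring.
rewrite /tri_weight /mopp /M11 /M12 /M21 /M22 /hsel_edges /= -addrA; congr (1 + (hsel _ _ _ + hsel _ _ _)); ring.
Qed.

(** A pair (i, j) stands for the triangle whose third cusp is vertex j minus vertex i. The hexagon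
    is cut into the triangles 012, 342, 024 and 045. *)
Definition triangulation (k : nat) : seq (nat * nat) :=
  if k == 2 then [:: (0, 1); (0, 2)]%N else [:: (0, 1); (3, 4); (0, 2); (0, 4)]%N.

Lemma sum_triangulation k M p : (k == 2)%N || (k == 3)%N -> 0 < p -> (forall x, x * x <> p) -> mdet M = p ->
  \sum_(l < k.*2) edgeM M (vtx k l) (vtx k l.+1) - (k.*2%:Z - 2) =
  \sum_(t <- triangulation k) tri_weight_sym M (vtx k t.1) (vtx k t.2).
Proof.
move=> hk p0 psq hd.
rewrite -(big_mkord xpredT (fun l => edgeM M (vtx k l) (vtx k l.+1))).
have tri i j q : wedge (vtx k i) (vtx k j) = -1 -> vtx k q = vlin 1 (vtx k j) (vtx k i) ->
   tri_weight_sym M (vtx k i) (vtx k j) = edgeM M (vtx k i) (vtx k j) + edgeM M (vtx k j) (vtx k q)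
     + edgeM M (vtx k q) (vopp (vtx k i)) - 1.
  by move=> h ->; rewrite (edgeM_triangle p0 psq hd h); ring.
case/orP: hk tri => /eqP -> tri; rewrite /triangulation /= /index_iota [iota _ _]/= !big_cons !big_nil /=.
  rewrite (tri 0 1 2)%N // (tri 0 2 3)%N // -[vtx 2 4]/(vopp (vtx 2 0)).
  rewrite (@edgeM_rev M (vtx 2 0) (vtx 2 2) p) //.
have -> : 2.*2%:Z = 4 by [].
ring.
rewrite (tri 0 1 2)%N // (tri 0 2 4)%N // (tri 0 4 5)%N // -[vtx 3 6]/(vopp (vtx 3 0)).
have e2 : vopp (vtx 3 2) = vlin 1 (vtx 3 4) (vtx 3 3) by [].
have -> : tri_weight_sym M (vtx 3 3) (vtx 3 4) = edgeM M (vtx 3 3) (vtx 3 4) + edgeM M (vtx 3 4) (vopp (vtx 3 2))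
   + edgeM M (vtx 3 2) (vtx 3 3) - 1.
  by rewrite e2 -(edgeM_NN M (vtx 3 2)) e2 (edgeM_triangle p0 psq hd) //; ring.
rewrite (@edgeM_rev M (vtx 3 0) (vtx 3 2) p) // (@edgeM_rev M (vtx 3 0) (vtx 3 4) p) //.
rewrite (@edgeM_rev M (vtx 3 2) (vtx 3 4) p) //.
have -> : 3.*2%:Z = 6 by [].
ring.
Qed.

Definition det_mats (P : nat) : seq mat := [seq N <- mat_box (4 * P) | mdet N == P%:Z].

Lemma hsel_neq0 X Y Z : hsel X Y Z != 0 -> [/\ 0 <= X, 0 <= Y & 0 <= Z].
Proof. by rewrite /hsel; case: ifP => [_ |/negbT]; rewrite ?eqxx // !negb_or -!leNgt => /andP[/andP[? ?] ?] _; split. Qed.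

Lemma sym2_bound (X Y Z : int) : 0 <= X -> 0 <= Y -> 0 <= Z -> 0 < Y + Z -> X <= X * Y + Y * Z + Z * X.
Proof. nia. Qed.

(** The Selling parameters X, Y, Z of the form are nonnegative and satisfy XY + YZ + ZX + tr^2 = 4P,
    and two of them cannot vanish together because P is not a square. *)
Lemma tri_weight_bound (P : nat) N : prime P -> mdet N = P%:Z -> tri_weight N != 0 -> N \in mat_box (4 * P).
Proof.
move=> hP hd; have P1 := prime_gt1 hP; rewrite /tri_weight /hsel_edges mem_mat_box.
case: N hd => [[[a b] c] d]; rewrite /mdet /M11 /M12 /M21 /M22 /= => hd /hsel_neq0[].
have -> : b - a + d - c + - c - b = d - a - 2 * c by ring.
have -> : b - a + d - c + b - - c = 2 * b - a + d by ring.
have -> : - c + b - (b - a + d - c) = a - d by ring.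
move=> hX hY hZ.
have eX : (d - a - 2 * c) * (2 * b - a + d) + (2 * b - a + d) * (a - d) + (a - d) * (d - a - 2 * c) + (a + d) * (a + d) = 4 * P%:Z.
  by rewrite -hd; ring.
have hns x := @prime_nonsquare P x hP.
have n1 : 0 < (2 * b - a + d) + (a - d).
  rewrite lt_neqAle addr_ge0 // andbT; apply/eqP => h0; apply: (hns a); rewrite -hd.
  have -> : b = 0 by lia.
  have -> : d = a by lia.
  ring.
have n2 : 0 < (a - d) + (d - a - 2 * c).
  rewrite lt_neqAle addr_ge0 // andbT; apply/eqP => h0; apply: (hns a); rewrite -hd.
  have -> : c = 0 by lia.
  have -> : d = a by lia.
  ring.
have n3 : 0 < (d - a - 2 * c) + (2 * b - a + d).
  rewrite lt_neqAle addr_ge0 // andbT; apply/eqP => h0; apply: (hns (d + b)); rewrite -hd.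
  have -> : c = - b by lia.
  have -> : a = d + 2 * b by lia.
  ring.
have bX := sym2_bound hX hY hZ n1; have bY := sym2_bound hY hZ hX n2; have bZ := sym2_bound hZ hX hY n3.
have s0 := mulr_ge0 hX hY; have s1 := mulr_ge0 hY hZ; have s2 := mulr_ge0 hZ hX.
have sr : 0 <= (a + d) * (a + d) by rewrite -expr2 sqr_ge0.
have lX : d - a - 2 * c <= 4 * P%:Z by lia.
have lY : 2 * b - a + d <= 4 * P%:Z by lia.
have lZ : a - d <= 4 * P%:Z by lia.
have br : `|a + d| <= 4 * P%:Z.
  have : (a + d) * (a + d) <= 4 * P%:Z by lia.
  by move: (a + d) => r; nia.
clear -hX hY hZ lX lY lZ br; lia.
Qed.

Lemma mem_det_mats P N : prime P -> tri_weight N != 0 -> (N \in det_mats P) = (mdet N == P%:Z).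
Proof.
move=> hP nz; rewrite mem_filter; case: eqP => //= hd; exact: tri_weight_bound hP hd nz.
Qed.

(** Matrices of nonzero weight are small, so the ball contains all of them. The terms for N and for
    -N give the same sum, whence the factor 2. *)
Lemma sum_tri_weight_sym k i j (P : nat) E B : (k == 2)%N || (k == 3)%N -> prime P -> fits (6 * P) B ->
  wedge (vtx k i) (vtx k j) = -1 -> (forall M, E (mopp M) = E M) ->
  \sum_(M <- sols k P%:Z E B) tri_weight_sym M (vtx k i) (vtx k j) =
  2 * \sum_(N <- det_mats P) (E (frame (vtx k i) (vtx k j) N))%:Z * tri_weight N.
Proof.
move=> hk hP hB; set x := vtx k i; set y := vtx k j => hv hE; have P1 := prime_gt1 hP.
have mo N : mopp (mopp N) = N by case: N => [[[a b] c] d]; rewrite /mopp /M11 /M12 /M21 /M22 /= !opprK.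
have fo N : frame x y (mopp N) = mopp (frame x y N).
  by case: N => [[[a b] c] d]; rewrite /mopp /frame; munf; congr (_, _, _, _); ring.
have dto N : mdet (mopp N) = mdet N by case: N => [[[a b] c] d]; rewrite /mopp; munf; ring.
have uK : uniq (det_mats P) by rewrite filter_uniq ?uniq_mat_box.
have inL N : mdet N = P%:Z -> tri_weight N != 0 -> E (frame x y N) -> frame x y N \in sols k P%:Z E B.
  move=> hd nz hEN; rewrite mem_sols // frame_mdet // hd eqxx hEN /=.
  by apply: (ball_frame _ _ hk (tri_weight_bound hP hd nz)); apply: fits_le hB; lia.
have frE N : mdet (frame x y N) = mdet N by apply: frame_mdet.
rewrite big_split mulrDl mul1r; apply: (f_equal2 (fun a b : int => a + b)).
  apply: (sum_reindex (f := unframe x y) (g := frame x y)) => //; first exact: uniq_sols.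
    move=> M; rewrite mem_sols // => /and3P[/eqP hd hEM _] nz; rewrite unframeK // hEM mul1r; split=> //.
    by rewrite mem_det_mats // unframe_mdet // hd.
  move=> N; rewrite mem_filter => /andP[/eqP hd _]; case hEN: (E _); rewrite ?mul0r ?eqxx // mul1r => nz.
  by rewrite frameK //; split=> //; apply: inL.
apply: (sum_reindex (f := fun M => mopp (unframe x y M)) (g := fun N => frame x y (mopp N))) => //; first exact: uniq_sols.
  move=> M; rewrite mem_sols // => /and3P[/eqP hd hEM _] nz; rewrite mo fo unframeK // hE hEM mul1r; split=> //.
  by rewrite mem_det_mats // dto unframe_mdet // hd.
move=> N; rewrite mem_filter => /andP[/eqP hd _]; case hEN: (E _); rewrite ?mul0r ?eqxx // mul1r => nz.
rewrite frameK // mo; split=> //; rewrite mem_sols // fo dto frE hd eqxx hE hEN /=.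
have := inL N hd nz hEN; rewrite mem_sols // => /and3P[_ _ /(ballP _ _ hk) hb].
apply/(ballP _ _ hk) => i' j'.
have -> : mact (mopp (frame x y N)) (vtx k j') = vopp (mact (frame x y N) (vtx k j')).
  by rewrite /mopp; munf; congr (_, _); ring.
by rewrite wedgeNr normrN.
Qed.

(** The three invariances of E serve the averaging of the sides, the merging of N with -N, and the
    cancellation of the crossing terms, respectively. *)
Lemma lefschetz_polygon k (P : nat) (E : pred mat) B : (k == 2)%N || (k == 3)%N -> prime P -> fits (6 * P) B ->
  (forall M, E (mmul M (rot_poly k)) = E M) -> (forall M, E (mopp M) = E M) ->
  (forall l M, mdet M = P%:Z -> E (frame (vtx k l) (vtx k l.+1) (mswap (unframe (vtx k l) (vtx k l.+1) M))) = E M) ->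
  4 * \sum_(t <- triangulation k) \sum_(N <- det_mats P) (E (frame (vtx k t.1) (vtx k t.2) N))%:Z * tri_weight N
  = \sum_(l < k.*2) \sum_(M <- sols k P%:Z E B) fix_vtx k M l + \sum_(l < k.*2) \sum_(M <- sols k P%:Z E B) adj_vtx k M l.
Proof.
move=> hk hP hB hE1 hE3 hE2; rewrite -sum_edges //.
have P1 := prime_gt1 hP.
have -> : \sum_(M <- sols k P%:Z E B) (\sum_(l < k.*2) edgeM M (vtx k l) (vtx k l.+1) - (k.*2%:Z - 2)) =
  \sum_(M <- sols k P%:Z E B) \sum_(t <- triangulation k) tri_weight_sym M (vtx k t.1) (vtx k t.2).
  apply: eq_big_seq => M; rewrite mem_sols // => /and3P[/eqP hd _ _].
  by apply: (sum_triangulation hk _ _ hd); [lia | move=> x; apply: prime_nonsquare].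
rewrite [in RHS]exchange_big /= (_ : 4 = 2 * 2) // -mulrA; apply: (f_equal (fun z : int => 2 * z)).
rewrite mulr_sumr; apply: eq_big_seq => t ht; rewrite sum_tri_weight_sym //.
move: ht; case/orP: hk => /eqP ->; rewrite /triangulation /= !inE => h; do ?[case/orP: h => h]; by move/eqP: h => ->.
Qed.

Lemma fits_exists (P : nat) : exists B, fits (6 * P) B.
Proof. by exists (4096 * (6 * P))%N; rewrite fitsE. Qed.

(** The quadrilateral without congruence condition: 8 times the sum is 48 (P - 1) from fixed
    vertices plus 48 (P + 1) from adjacent ones. Divided by 6 the result is the Hurwitz-Kronecker
    relation with total 2P. *)
Lemma sum_tri_weight (P : nat) : prime P -> \sum_(N <- det_mats P) tri_weight N = 12 * P%:Z.
Proof.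
move=> hP; have [B hB] := fits_exists P.
have := @lefschetz_polygon 2 P xpredT B isT hP hB (fun _ => erefl) (fun _ => erefl) (fun _ _ _ => erefl).
have fx l : \sum_(M <- sols 2 P%:Z xpredT B) fix_vtx 2 M l = 8 * wt 2 l.+1 * (P%:Z - 1).
  have := @sum_fix_vtx 2 l P xpredT B 1 isT hP hB ltr01; rewrite mul1r; apply; rewrite ?dvd1z // => d1 d2 X _.
  by rewrite dvd1z.
have ad l : \sum_(M <- sols 2 P%:Z xpredT B) adj_vtx 2 M l = 4 * (wt 2 l.+1 + wt 2 l.+2) * (P%:Z + 1).
  have := @sum_adj_vtx 2 l P xpredT B 1 isT hP hB ltr01; rewrite mul1r; apply; rewrite ?dvd1z // => d1 d2 X _.
  by rewrite dvd1z.
rewrite -(big_mkord xpredT (fun l => \sum_(M <- sols 2 P%:Z xpredT B) fix_vtx 2 M l)).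
rewrite -(big_mkord xpredT (fun l => \sum_(M <- sols 2 P%:Z xpredT B) adj_vtx 2 M l)).
rewrite /index_iota [iota _ _]/= /triangulation !big_cons !big_nil !fx !ad /wt [odd 1]/= [odd 2]/= [odd 3]/= [odd 4]/= [odd 5]/=.
rewrite (eq_bigr tri_weight) => [|N _]; last by rewrite mul1r.
move: (\sum_(i <- det_mats P) tri_weight i) => S; clear -S P => h; have: 8 * S = 96 * P%:Z; last by lia.
rewrite (_ : 8 * S = 4 * (S + (S + 0))); last by ring.
by rewrite h; ring.
Qed.

(** * Congruence conditions modulo 3 *)

Lemma mod3P (x : int) : exists q i : int, x = 3 * q + i /\ (i = 0 \/ i = 1 \/ i = 2).
Proof. exists (x %/ 3)%Z, (x %% 3)%Z; split; lia. Qed.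

Lemma dvd3_lin (q i : int) : (3 %| 3 * q + i)%Z = (3 %| i)%Z.
Proof. lia. Qed.

Definition scal3 (M : mat) : bool := [&& (3 %| M12 M)%Z, (3 %| M21 M)%Z & (3 %| M11 M - M22 M)%Z].
(* Modulo 3, the elements of order 4 and the scalars form the quaternion subgroup of SL_2(F_3). *)
Definition in_Q8 (M : mat) : bool := ((mdet M %% 3)%Z == 1) && ((3 %| mtr M)%Z || scal3 M).

Lemma frame_inv x y N : wedge x y = -1 -> frame (- y.2, x.2) (y.1, - x.1) (frame x y N) = N.
Proof.
move=> h; have h2 : wedge x y * wedge x y = 1 by rewrite h.
case: N => [[[a b] c] d]; rewrite -[RHS]/(a, b, c, d).
have -> : frame (- y.2, x.2) (y.1, - x.1) (frame x y (a, b, c, d)) =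
  (wedge x y * wedge x y * a, wedge x y * wedge x y * b, wedge x y * wedge x y * c, wedge x y * wedge x y * d).
  by rewrite /frame; munf; congr (_, _, _, _); ring.
by rewrite h2 !mul1r.
Qed.

Lemma scal3_frame x y N : wedge x y = -1 -> scal3 (frame x y N) = scal3 N.
Proof.
have fwd u v M : scal3 M -> scal3 (frame u v M).
  case: M u v => [[[a b] c] d] [u1 u2] [v1 v2]; rewrite /scal3 /frame; munf => /and3P[/dvdzP[b' eb] /dvdzP[c' ec] /dvdzP[e ee]].
  have -> : a = d + e * 3 by rewrite -ee; ring.
  rewrite eb ec; apply/and3P; split; apply/dvdzP.
  - exists (u1 * v1 * e + v1 * v1 * c' - u1 * u1 * b'); ring.
  - exists (- u2 * v2 * e - v2 * v2 * c' + u2 * u2 * b'); ring.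
  - exists (- (u1 * v2 + u2 * v1) * e - 2 * v1 * v2 * c' + 2 * u1 * u2 * b'); ring.
move=> h; apply/idP/idP; last exact: fwd.
by move/(fwd (- y.2, x.2) (y.1, - x.1)); rewrite frame_inv.
Qed.

Lemma in_Q8_frame x y N : wedge x y = -1 -> in_Q8 (frame x y N) = in_Q8 N.
Proof. by move=> h; rewrite /in_Q8 frame_mdet // frame_mtr // scal3_frame. Qed.

(** The rotation of the quadrilateral has determinant 1 and trace 0, so it lies in the quaternion
    subgroup itself. The check runs over all residues of the entries. *)
Lemma in_Q8_rot_poly M : in_Q8 (mmul M (rot_poly 2)) = in_Q8 M.
Proof.
rewrite /in_Q8 mdet_mul.
have -> : mdet (rot_poly 2) = 1 by [].
rewrite mulr1; case: eqP => //= hd.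
case: M hd => [[[a b] c] d]; rewrite /scal3 /rot_poly /mtr; munf => hd.
have {hd} : (3 %| a * d - b * c - 1)%Z by lia.
have -> : a * -1 + b * - 2%:Z + (c * 1 + d * (2%:Z - 1)) = 3 * (- b) + (- a + b + c + d) by ring.
have -> : a * 1 + b * (2%:Z - 1) = a + b by ring.
have -> : c * -1 + d * - 2%:Z = 3 * (- d) + (d - c) by ring.
have -> : a * -1 + b * - 2%:Z - (c * 1 + d * (2%:Z - 1)) = 3 * (- b) + (- a + b - c - d) by ring.
rewrite !dvd3_lin.
have [a' [i [-> hi]]] := mod3P a; have [b' [j [-> hj]]] := mod3P b.
have [c' [k [-> hk]]] := mod3P c; have [d' [l [-> hl]]] := mod3P d.
have -> : (3 * a' + i) * (3 * d' + l) - (3 * b' + j) * (3 * c' + k) - 1 =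
  3 * (3 * a' * d' + a' * l + i * d' - 3 * b' * c' - b' * k - j * c') + (i * l - j * k - 1) by ring.
have -> : 3 * a' + i + (3 * d' + l) = 3 * (a' + d') + (i + l) by ring.
have -> : 3 * a' + i - (3 * d' + l) = 3 * (a' - d') + (i - l) by ring.
have -> : - (3 * a' + i) + (3 * b' + j) + (3 * c' + k) + (3 * d' + l) = 3 * (- a' + b' + c' + d') + (- i + j + k + l) by ring.
have -> : - (3 * a' + i) + (3 * b' + j) - (3 * c' + k) - (3 * d' + l) = 3 * (- a' + b' - c' - d') + (- i + j - k - l) by ring.
have -> : 3 * a' + i + (3 * b' + j) = 3 * (a' + b') + (i + j) by ring.
have -> : 3 * d' + l - (3 * c' + k) = 3 * (d' - c') + (l - k) by ring.
rewrite !dvd3_lin.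
by move: hi hj hk hl => [->|[->|->]] [->|[->|->]] [->|[->|->]] [->|[->|->]].
Qed.

Lemma in_Q8_swap x y M : wedge x y = -1 -> in_Q8 (frame x y (mswap (unframe x y M))) = in_Q8 M.
Proof.
move=> h; rewrite in_Q8_frame // -[in RHS](unframeK M h) in_Q8_frame //.
case: (unframe x y M) => [[[a b] c] d]; rewrite /in_Q8 /scal3 /mswap; munf.
by rewrite (mulrC d) (addrC d) -(opprB a d) rpredN.
Qed.

Lemma in_Q8_opp M : in_Q8 (mopp M) = in_Q8 M.
Proof.
case: M => [[[a b] c] d]; rewrite /in_Q8 /scal3 /mopp; munf.
have -> : - a - d = - (a + d) by ring.
have -> : - a - - d = - (a - d) by ring.
by rewrite !mulrNN !rpredN.
Qed.

(** At a fixed vertex the diagonal entries agree modulo 3, so the trace is prime to 3 and the matrix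
    must be scalar modulo 3; at an adjacent vertex X is the trace. Both conditions read 3 | X, so
    [sum_window] applies with e = 3. *)
Lemma sum_tri_weight_Q8 (P : nat) : prime P -> (P %% 3 = 1)%N ->
  \sum_(N <- det_mats P) (in_Q8 N)%:Z * tri_weight N = 4 * P%:Z.
Proof.
move=> hP h3; have [B hB] := fits_exists P.
have := @lefschetz_polygon 2 P in_Q8 B isT hP hB in_Q8_rot_poly in_Q8_opp (fun l M _ => in_Q8_swap M (wedge_vtx 2 l)).
have fE d1 d2 X : d1 * d2 = P%:Z -> in_Q8 (d1, X, 0, d2) = (3 %| X)%Z.
  move=> h; rewrite /in_Q8 /scal3; munf; rewrite h mulr0 subr0.
  have [a' [i [ea hi]]] := mod3P d1; have [d' [j [ed hj]]] := mod3P d2.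
  have : (3 %| i * j - 1)%Z.
    rewrite -(dvd3_lin (3 * a' * d' + a' * j + i * d')).
    have -> : 3 * (3 * a' * d' + a' * j + i * d') + (i * j - 1) = d1 * d2 - 1 by rewrite ea ed; ring.
    by rewrite h; lia.
  by move: hi hj ea ed => [->|[->|->]] [->|[->|->]] ea ed //; lia.
have aE d1 d2 X : d1 * d2 = P%:Z -> in_Q8 (X, d1, - d2, 0) = (3 %| X)%Z.
  move=> h; rewrite /in_Q8 /scal3; munf; rewrite mulr0 sub0r mulrN opprK h addr0.
  have : ~ (3 %| d1)%Z by move=> /dvdzP[q e]; move: h; rewrite e; lia.
  lia.
have fx l : 3 * \sum_(M <- sols 2 P%:Z in_Q8 B) fix_vtx 2 M l = 8 * wt 2 l.+1 * (P%:Z - 1).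
  apply: (@sum_fix_vtx 2 l P in_Q8 B 3 isT hP hB isT) => [d1 d2 X h|]; first by rewrite in_Q8_frame ?wedge_vtx // fE.
  by apply: dvdz_mull; lia.
have ad l : 3 * \sum_(M <- sols 2 P%:Z in_Q8 B) adj_vtx 2 M l = 4 * (wt 2 l.+1 + wt 2 l.+2) * (P%:Z + 1).
  apply: (@sum_adj_vtx 2 l P in_Q8 B 3 isT hP hB isT) => [d1 d2 X h||]; first by rewrite in_Q8_frame ?wedge_vtx // aE.
    by rewrite /wt /= negbK; case: odd => /=; rewrite ?mul1r; clear -h3; lia.
  by rewrite /wt /= negbK; case: odd => /=; rewrite ?mul1r; clear -h3; lia.
move=> /(congr1 (fun x => 3 * x)); rewrite mulrDr !mulr_sumr.
rewrite -(big_mkord xpredT (fun l => 3 * \sum_(M <- sols 2 P%:Z in_Q8 B) fix_vtx 2 M l)).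
rewrite -(big_mkord xpredT (fun l => 3 * \sum_(M <- sols 2 P%:Z in_Q8 B) adj_vtx 2 M l)).
rewrite /index_iota [iota _ _]/= /triangulation !big_cons !big_nil !fx !ad /wt [odd 1]/= [odd 2]/= [odd 3]/= [odd 4]/= [odd 5]/=.
have fr i j : wedge (vtx 2 i) (vtx 2 j) = -1 ->
  \sum_(N <- det_mats P) (in_Q8 (frame (vtx 2 i) (vtx 2 j) N))%:Z * tri_weight N = \sum_(N <- det_mats P) (in_Q8 N)%:Z * tri_weight N.
  by move=> h; apply: eq_bigr => N _; rewrite in_Q8_frame.
rewrite (fr 0%N 1%N erefl) (fr 0%N 2%N erefl).
move: (\sum_(N <- det_mats P) _) => S; clear => h; have: 24 * S = 96 * P%:Z; last by lia.
rewrite (_ : 24 * S = 3 * (4 * S) + (3 * (4 * S) + 0)); last by ring.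
by rewrite h; ring.
Qed.

Lemma vtx3_odd l : (3 %| (vtx 3 l).2)%Z = odd l.
Proof.
elim/nat_step2_ind: l => [//|//|l h0 h1].
have -> : (vtx 3 l.+2).2 = wt 3 l.+1 * (vtx 3 l.+1).2 - (vtx 3 l).2 by rewrite vtxSS.
rewrite /= negbK -h0 rpredDl ?rpredN //; move: h1; rewrite /wt /=.
by case: (odd l) => /= h; [apply: dvdz_mulr | rewrite mul1r].
Qed.

Definition Gam0 (M : mat) : bool := (3 %| M21 M)%Z.

Lemma dvd3_mulN2 (y c : int) : ~~ (3 %| y)%Z -> (3 %| y * y * c)%Z = (3 %| c)%Z.
Proof.
have [q [i [-> hi]]] := mod3P y; rewrite dvd3_lin => h.
have -> : (3 * q + i) * (3 * q + i) * c = 3 * ((3 * q * q + 2 * q * i) * c) + i * i * c by ring.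
by rewrite dvd3_lin; move: hi h => [->|[->|->]] // _; rewrite -?mulrA; lia.
Qed.

(** Modulo 3 the odd vertices reduce to the point (1 : 0), and [Gam0] says that this point is fixed.
    Each edge has one odd end, and the condition does not see the diagonal entries. *)
Lemma Gam0_frame l N : Gam0 (frame (vtx 3 l) (vtx 3 l.+1) N) = if odd l then (3 %| M21 N)%Z else (3 %| M12 N)%Z.
Proof.
have := vtx3_odd l; have := vtx3_odd l.+1; rewrite /Gam0.
move: (vtx 3 l) (vtx 3 l.+1) => [x1 x2] [y1 y2]; case: N => [[[a b] c] d]; rewrite /frame; munf => hy hx.
have -> : (x2 * a + y2 * c) * - y2 + (x2 * b + y2 * d) * x2 = (x2 * y2) * (d - a) + (x2 * x2 * b - y2 * y2 * c) by ring.
have hxy : (3 %| x2 * y2 * (d - a))%Z.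
  by apply: dvdz_mulr; move: hx hy; case: odd => /= hx hy; [apply: dvdz_mulr | apply: dvdz_mull].
rewrite rpredDl //; move: hx hy; case: odd => /= hx hy.
  rewrite rpredDl; last by rewrite -mulrA; apply: dvdz_mulr.
  by rewrite rpredN dvd3_mulN2 ?hy.
by rewrite rpredDr ?dvd3_mulN2 ?hx // rpredN -mulrA dvdz_mulr.
Qed.

(* The number of fixed points of N on the projective line over F_3. *)
Definition nfix (N : mat) : int :=
  (3 %| M12 N)%Z%:Z + (3 %| M21 N)%Z%:Z + (3 %| M11 N - M22 N - M21 N + M12 N)%Z%:Z
  + (3 %| - (M11 N - M22 N) - M21 N + M12 N)%Z%:Z.

(** Transported to the four triangles of the hexagon, [Gam0] becomes the condition of fixing each of
    the four points of P^1(F_3), and the sum over the triangles counts fixed points. *)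
Lemma sum_nfix (P : nat) : prime P -> (P != 3)%N -> \sum_(N <- det_mats P) nfix N * tri_weight N = 12 * (P%:Z - 1).
Proof.
move=> hP h3; have [B hB] := fits_exists P.
have n3 : ~~ (3 %| P%:Z)%Z by rewrite dvdzE /= dvdn_prime2 // eq_sym.
have hE1 M : Gam0 (mmul M (rot_poly 3)) = Gam0 M.
  case: M => [[[a b] c] d]; rewrite /Gam0 /rot_poly; munf.
  have -> : c * -1 + d * - 3%:Z = - c + 3 * (- d) by ring.
  by rewrite rpredDr ?rpredN // dvdz_mulr.
have hE2 M : Gam0 (mopp M) = Gam0 M by rewrite /Gam0 /mopp /= rpredN.
have hE3 l M : mdet M = P%:Z -> Gam0 (frame (vtx 3 l) (vtx 3 l.+1) (mswap (unframe (vtx 3 l) (vtx 3 l.+1) M))) = Gam0 M.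
  move=> _; rewrite -[in RHS](unframeK M (wedge_vtx 3 l)) !Gam0_frame.
  by case: (unframe _ _ M) => [[[a b] c] d].
have := @lefschetz_polygon 3 P Gam0 B isT hP hB hE1 hE2 hE3.
have fx l : \sum_(M <- sols 3 P%:Z Gam0 B) fix_vtx 3 M l = 8 * (P%:Z - 1).
  have w0 : 0 < wt 3 l.+1 by rewrite /wt; case: odd.
  apply: (mulfI (lt0r_neq0 w0)); rewrite (@sum_fix_vtx 3 l P Gam0 B _ isT hP hB w0); first by ring.
    move=> d1 d2 X _; rewrite Gam0_frame /M21 /M12 /wt /=.
    by case: (odd l) => //=; rewrite dvd1z.
  by rewrite dvdz_mulr.
(* With lower right entry 0 the determinant is -bc, and [Gam0] makes 3 divide b or c, although 3
   does not divide P. *)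
have ad l : \sum_(M <- sols 3 P%:Z Gam0 B) adj_vtx 3 M l = 0.
  apply: big1_seq => M /andP[_]; rewrite mem_sols // => /and3P[/eqP hd hE _].
  move: hd hE; rewrite -(unframeK M (wedge_vtx 3 l.+1)) frame_mdet ?wedge_vtx // Gam0_frame.
  case: (unframe _ _ M) => [[[a b] c] d]; rewrite adj_vtx_frame; case: (d =P 0) => [->|_ _ _]; last by rewrite mul0r.
  munf; rewrite mulr0 sub0r => hd h; case/negP: n3; rewrite -hd rpredN.
  by move: h; case: (~~ odd l) => h; [apply: dvdz_mull | apply: dvdz_mulr].
rewrite -(big_mkord xpredT (fun l => \sum_(M <- sols 3 P%:Z Gam0 B) fix_vtx 3 M l)).
rewrite -(big_mkord xpredT (fun l => \sum_(M <- sols 3 P%:Z Gam0 B) adj_vtx 3 M l)).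
rewrite /index_iota [iota _ _]/= /triangulation !big_cons !big_nil !fx !ad ![(_, _).1]/= ![(_, _).2]/=.
have f1 N : Gam0 (frame (vtx 3 0) (vtx 3 1) N) = (3 %| M12 N)%Z by rewrite Gam0_frame.
have f2 N : Gam0 (frame (vtx 3 3) (vtx 3 4) N) = (3 %| M21 N)%Z by rewrite Gam0_frame.
have f3 N : Gam0 (frame (vtx 3 0) (vtx 3 2) N) = (3 %| M11 N - M22 N - M21 N + M12 N)%Z.
  rewrite /Gam0 -[vtx 3 0]/((0, 1) : vec) -[vtx 3 2]/((1, 2) : vec); case: N => [[[a b] c] d]; rewrite /frame; munf.
  rewrite -[RHS](dvd3_lin (- (a + c) + d)); congr (dvdz _ _); ring.
have f4 N : Gam0 (frame (vtx 3 0) (vtx 3 4) N) = (3 %| - (M11 N - M22 N) - M21 N + M12 N)%Z.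
  rewrite /Gam0 -[vtx 3 0]/((0, 1) : vec) -[vtx 3 4]/((1, 1) : vec); case: N => [[[a b] c] d]; rewrite /frame; munf.
  congr (dvdz _ _); ring.
rewrite (eq_bigr _ (fun N _ => f_equal (fun z : bool => z%:Z * tri_weight N) (f1 N))).
rewrite (eq_bigr _ (fun N _ => f_equal (fun z : bool => z%:Z * tri_weight N) (f2 N))).
rewrite (eq_bigr _ (fun N _ => f_equal (fun z : bool => z%:Z * tri_weight N) (f3 N))).
rewrite (eq_bigr _ (fun N _ => f_equal (fun z : bool => z%:Z * tri_weight N) (f4 N))).
have -> : \sum_(N <- det_mats P) nfix N * tri_weight N = \sum_(N <- det_mats P) (3 %| M12 N)%Z%:Z * tri_weight N + (\sum_(N <- det_mats P) (3 %| M21 N)%Z%:Z * tri_weight N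
  + (\sum_(N <- det_mats P) (3 %| M11 N - M22 N - M21 N + M12 N)%Z%:Z * tri_weight N + (\sum_(N <- det_mats P) (3 %| - (M11 N - M22 N) - M21 N + M12 N)%Z%:Z * tri_weight N + 0))).
  by rewrite addr0 -!big_split /=; apply: eq_bigr => N _; rewrite /nfix; ring.
set S := _ + (_ + _) => h; apply: (mulfI (_ : 4 != 0 :> int)) => //.
by rewrite h; ring.
Qed.

(** Over F_3 and for determinant 1 the characteristic polynomial is irreducible for trace 0 and has
    a double root otherwise: one fixed point, or four for a scalar. For determinant 2 it splits into
    distinct factors exactly for trace 0. *)
Lemma nfix_mod3 N (e : int) : (3 %| mdet N - e)%Z ->
  (e = 1 -> nfix N = (~~ (3 %| mtr N)%Z)%:Z + 3 * (scal3 N)%:Z /\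
            ((3 %| mtr N)%Z || scal3 N)%:Z = (3 %| mtr N)%Z%:Z + (scal3 N)%:Z :> int) /\
  (e = 2 -> nfix N = 2 * (3 %| mtr N)%Z%:Z).
Proof.
case: N => [[[a b] c] d]; rewrite /nfix /scal3; munf.
have [a' [i [-> hi]]] := mod3P a; have [b' [j [-> hj]]] := mod3P b.
have [c' [k [-> hk]]] := mod3P c; have [d' [l [-> hl]]] := mod3P d.
have -> : (3 * a' + i) * (3 * d' + l) - (3 * b' + j) * (3 * c' + k) - e =
  3 * (3 * a' * d' + a' * l + i * d' - 3 * b' * c' - b' * k - j * c') + (i * l - j * k - e) by ring.
have -> : 3 * a' + i + (3 * d' + l) = 3 * (a' + d') + (i + l) by ring.
have -> : 3 * a' + i - (3 * d' + l) - (3 * c' + k) + (3 * b' + j) = 3 * (a' - d' - c' + b') + (i - l - k + j) by ring.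
have -> : - (3 * a' + i - (3 * d' + l)) - (3 * c' + k) + (3 * b' + j) = 3 * (- (a' - d') - c' + b') + (- (i - l) - k + j) by ring.
have -> : 3 * a' + i - (3 * d' + l) = 3 * (a' - d') + (i - l) by ring.
rewrite !dvd3_lin => h; split=> he; move: h; rewrite he {he}.
  by move: hi hj hk hl => [->|[->|->]] [->|[->|->]] [->|[->|->]] [->|[->|->]].
by move: hi hj hk hl => [->|[->|->]] [->|[->|->]] [->|[->|->]] [->|[->|->]].
Qed.

(** * Weighted sums over traces divisible by 3 or prime to 3 *)

Lemma sum_trace_split (P : nat) : prime P ->
  \sum_(N <- det_mats P | (3 %| mtr N)%Z) tri_weight N + \sum_(N <- det_mats P | ~~ (3 %| mtr N)%Z) tri_weight N = 12 * P%:Z.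
Proof. by move=> hP; rewrite -sum_tri_weight // [RHS](bigID (fun N => (3 %| mtr N)%Z)). Qed.

(** With x, y, z the sums over trace divisible by 3, trace prime to 3, and scalars modulo 3, the
    relations are x + z = 4P, y + 3z = 12 (P - 1) and x + y = 12P. *)
Lemma sum_trace_mod1 (P : nat) : prime P -> (P %% 3 = 1)%N ->
  \sum_(N <- det_mats P | (3 %| mtr N)%Z) tri_weight N = 3 * P%:Z + 3.
Proof.
move=> hP h3; have n3 : P != 3%N by apply/eqP => e; rewrite e in h3.
have := sum_trace_split hP; have := sum_nfix hP n3; have := sum_tri_weight_Q8 hP h3.
have hd N : N \in det_mats P -> (3 %| mdet N - 1)%Z.
  by rewrite mem_filter => /andP[/eqP -> _]; lia.
have -> : \sum_(N <- det_mats P) (in_Q8 N)%:Z * tri_weight N = \sum_(N <- det_mats P | (3 %| mtr N)%Z) tri_weight N + \sum_(N <- det_mats P | scal3 N) tri_weight N.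
  rewrite [X in _ = X + _]big_mkcond [X in _ = _ + X]big_mkcond -big_split /=; apply: eq_big_seq => N hN'.
  have [/(_ erefl)[_ h] _] := nfix_mod3 (hd N hN').
  have -> : in_Q8 N = (3 %| mtr N)%Z || scal3 N by rewrite /in_Q8; have := hd N hN'; case: eqP => //; lia.
  by rewrite h; case: (_ %| _)%Z; case: scal3; rewrite ?mul1r ?mul0r ?add0r ?addr0 // mulrDl mul1r.
have -> : \sum_(N <- det_mats P) nfix N * tri_weight N = \sum_(N <- det_mats P | ~~ (3 %| mtr N)%Z) tri_weight N + 3 * \sum_(N <- det_mats P | scal3 N) tri_weight N.
  rewrite [X in _ = X + _]big_mkcond [X in _ = _ + 3 * X]big_mkcond mulr_sumr -big_split /=; apply: eq_big_seq => N hN'.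
  have [/(_ erefl)[-> _] _] := nfix_mod3 (hd N hN').
  by case: (_ %| _)%Z; case: scal3; rewrite /= ?mulr1 ?mulr0 ?add0r ?addr0 ?mul0r ?mul1r // mulrDl mul1r.
move: (\sum_(N <- det_mats P | (3 %| mtr N)%Z) tri_weight N) (\sum_(N <- det_mats P | ~~ (3 %| mtr N)%Z) tri_weight N) (\sum_(N <- det_mats P | scal3 N) tri_weight N) => x y z.
clear; lia.
Qed.

Lemma sum_trace_mod2 (P : nat) : prime P -> (P %% 3 = 2)%N ->
  \sum_(N <- det_mats P | (3 %| mtr N)%Z) tri_weight N = 6 * (P%:Z - 1).
Proof.
move=> hP h3; have n3 : P != 3%N by apply/eqP => e; rewrite e in h3.
have := sum_nfix hP n3.
have -> : \sum_(N <- det_mats P) nfix N * tri_weight N = 2 * \sum_(N <- det_mats P | (3 %| mtr N)%Z) tri_weight N.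
  rewrite [in RHS]big_mkcond mulr_sumr; apply: eq_big_seq => N; rewrite mem_filter => /andP[/eqP hd _].
  have h2 : (3 %| mdet N - 2)%Z by rewrite hd; lia.
  have [_ /(_ erefl) ->] := nfix_mod3 h2.
  by case: (_ %| _)%Z; rewrite ?mulr1 ?mulr0 ?mul0r.
move: (\sum_(N <- det_mats P | (3 %| mtr N)%Z) tri_weight N) => x; clear; lia.
Qed.

(** * Selling reduction and class numbers *)

Ltac bunf := rewrite /bqf_act /qa /qb /qc /=.

Lemma bqf_act1 f : bqf_act f 1 0 0 1 = f.
Proof. by case: f => [[a b] c]; bunf; congr (_, _, _); ring. Qed.

Lemma bqf_actM f al be ga de al' be' ga' de' :
  bqf_act (bqf_act f al be ga de) al' be' ga' de' =
  bqf_act f (al * al' + be * ga') (al * be' + be * de') (ga * al' + de * ga') (ga * be' + de * de').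
Proof. by case: f => [[a b] c]; bunf; congr (_, _, _); ring. Qed.

Lemma sl2_refl f : sl2_equiv f f.
Proof. by exists 1, 0, 0, 1; rewrite bqf_act1. Qed.

Lemma sl2_trans f g k : sl2_equiv f g -> sl2_equiv g k -> sl2_equiv f k.
Proof.
move=> [al [be [ga [de [h ->]]]]] [al' [be' [ga' [de' [h' ->]]]]]; rewrite bqf_actM.
eexists _, _, _, _; split; last reflexivity.
transitivity ((al * de - be * ga) * (al' * de' - be' * ga')); first by ring.
by rewrite h h'.
Qed.

Lemma sl2_sym f g : sl2_equiv f g -> sl2_equiv g f.
Proof.
move=> [al [be [ga [de [h ->]]]]]; exists de, (- be), (- ga), al.
have h2 : de * al - (- be) * (- ga) = 1 by rewrite -h; ring.
split=> //; rewrite bqf_actM -{1}(bqf_act1 f); congr (bqf_act _ _ _ _ _); rewrite -?h; ring.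
Qed.

Lemma disc_act f al be ga de : al * de - be * ga = 1 -> disc (bqf_act f al be ga de) = disc f.
Proof.
move=> h; transitivity ((al * de - be * ga) * (al * de - be * ga) * disc f); last by rewrite h !mul1r.
by case: f => [[a b] c]; rewrite /disc; bunf; ring.
Qed.

Lemma qa_act_gt0 (N : nat) f x y : posdef_disc N f -> (0 < N)%N -> x != 0 \/ y != 0 ->
  0 < qa f * x ^+ 2 + qb f * x * y + qc f * y ^+ 2.
Proof.
case: f => [[a b] c]; rewrite /posdef_disc /disc; bunf => -[hd [ha hc]] N0 hxy.
rewrite -(pmulr_rgt0 _ (ltr0n _ 4 : 0 < 4 :> int)) -(pmulr_rgt0 _ ha).
have -> : a * (4 * (a * x ^+ 2 + b * x * y + c * y ^+ 2)) = (2 * a * x + b * y) ^+ 2 + N%:Z * y ^+ 2.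
  have -> : N%:Z = - (b ^+ 2 - 4 * a * c) by rewrite hd opprK.
  by ring.
case: (y =P 0) hxy => [->|/eqP hy] hxy.
  case: hxy => // hx; rewrite mulr0 addr0 expr0n mulr0 addr0 exprn_even_gt0 //=.
  by rewrite !mulf_neq0 // gt_eqF.
apply: ltr_wpDl; first exact: sqr_ge0.
by rewrite mulr_gt0 ?exprn_even_gt0 //; lia.
Qed.

Lemma posdef_act (N : nat) f al be ga de : posdef_disc N f -> (0 < N)%N -> al * de - be * ga = 1 ->
  posdef_disc N (bqf_act f al be ga de).
Proof.
move=> hf N0 h; split; first by rewrite disc_act //; case: hf.
split; apply: (qa_act_gt0 hf N0).
  case: (al =P 0) => [h1|_]; last by left.
  by right; apply/eqP => h2; move: h; rewrite h1 h2 mulr0 mul0r subrr.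
case: (be =P 0) => [h1|_]; last by left.
by right; apply/eqP => h2; move: h; rewrite h1 h2 mulr0 mul0r subrr.
Qed.

Lemma posdef_equiv (N : nat) f g : posdef_disc N f -> (0 < N)%N -> sl2_equiv f g -> posdef_disc N g.
Proof. by move=> hf N0 [al [be [ga [de [h ->]]]]]; apply: posdef_act. Qed.

Definition sel_rot (f : bqf) : bqf := (qa f + qb f + qc f, - (2 * qa f + qb f), qa f).
(* Selling parameters: 2 f(x, y) = X x^2 + Y y^2 + Z (x - y)^2. *)
Definition selX (f : bqf) : int := 2 * qa f + qb f.
Definition selY (f : bqf) : int := 2 * qc f + qb f.
Definition selZ (f : bqf) : int := - qb f.
Definition sel_sum (f : bqf) : int := selX f + selY f + selZ f.
Definition sel_weight (f : bqf) : int := hsel (selX f) (selY f) (selZ f).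
Definition selling (f : bqf) : Prop := [/\ 0 <= selX f, 0 <= selY f & 0 <= selZ f].

Lemma sel_rot_equiv f : sl2_equiv f (sel_rot f).
Proof. by exists 1, (-1), 1, 0; split=> //; case: f => [[a b] c]; rewrite /sel_rot; bunf; congr (_, _, _); ring. Qed.

Lemma sel_rot_sel f : [/\ selX (sel_rot f) = selY f, selY (sel_rot f) = selZ f & selZ (sel_rot f) = selX f].
Proof. by case: f => [[a b] c]; rewrite /sel_rot /selX /selY /selZ; bunf; split; ring. Qed.

Lemma disc_sel f : - disc f = selX f * selY f + selY f * selZ f + selZ f * selX f.
Proof. by case: f => [[a b] c]; rewrite /disc /selX /selY /selZ; bunf; ring. Qed.

Lemma sel_inj f g : selX f = selX g -> selY f = selY g -> selZ f = selZ g -> f = g.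
Proof.
case: f => [[a b] c]; case: g => [[a' b'] c']; rewrite /selX /selY /selZ; bunf => hx hy hz.
congr (_, _, _); lia.
Qed.

(* Selling's descent: an obtuse superbase is reached by decreasing f(1,0) + f(0,1) + f(1,1). *)
Lemma selling_exists (N : nat) f : (0 < N)%N -> posdef_disc N f ->
  exists2 g, sl2_equiv f g & selling g.
Proof.
move=> N0; suff: forall (n : nat) f, posdef_disc N f -> sel_sum f < n%:Z -> exists2 g, sl2_equiv f g & selling g.
  by move=> h hf; apply: (h (absz (sel_sum f)).+1 f hf); lia.
elim=> [|n IH] {}f hf hs.
  have := qa_act_gt0 (x := 1) (y := 1) hf N0 (or_introl isT); case: hf => _ [].
  by move: hs; rewrite /sel_sum /selX /selY /selZ; case: f => [[a b] c]; bunf; lia.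
have step g : sl2_equiv f g -> sel_sum g = sel_sum f -> selZ g < 0 -> exists2 g, sl2_equiv f g & selling g.
  move=> hg es hz; have hgS : sl2_equiv g (qc g, - qb g, qa g).
    by exists 0, (-1), 1, 0; split=> //; case: (g) => [[a b] c]; bunf; congr (_, _, _); ring.
  have hfS := sl2_trans hg hgS; case: (IH _ (posdef_equiv hf N0 hfS)).
    by move: es hz hs; rewrite /sel_sum /selX /selY /selZ; case: (g) => [[a b] c]; bunf; lia.
  by move=> k hk sk; exists k => //; apply: sl2_trans hfS hk.
have [x1 y1 z1] := sel_rot_sel f; have [x2 y2 z2] := sel_rot_sel (sel_rot f).
case: (ltP (selZ f) 0) => hz; first by apply: (step f) => //; apply: sl2_refl.
case: (ltP (selX f) 0) => hx.
  apply: (step (sel_rot f)); rewrite ?z1 //; [exact: sel_rot_equiv | by rewrite /sel_sum x1 y1 z1; ring].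
case: (ltP (selY f) 0) => hy.
  apply: (step (sel_rot (sel_rot f))); rewrite ?z2 ?x1 //; first exact: sl2_trans (sel_rot_equiv _) (sel_rot_equiv _).
  by rewrite /sel_sum x2 y2 z2 x1 y1 z1; ring.
by exists f; [exact: sl2_refl | split].
Qed.

(** At most one Selling parameter vanishes, as the discriminant is nonzero, and [sel_rot] moves it
    to the third place. *)
Lemma selling_exists_pos (N : nat) f : (0 < N)%N -> posdef_disc N f ->
  exists g, [/\ sl2_equiv f g, 0 < selX g, 0 < selY g & 0 <= selZ g].
Proof.
move=> N0 hf; have [g hg [hx hy hz]] := selling_exists N0 hf.
have := disc_sel g; have [-> _] := posdef_equiv hf N0 hg; rewrite opprK => hd.
have [x1 y1 z1] := sel_rot_sel g; have [x2 y2 z2] := sel_rot_sel (sel_rot g).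
case: (selX g =P 0) => ex.
  exists (sel_rot g); split; rewrite ?x1 ?y1 ?z1 //; first exact: sl2_trans hg (sel_rot_equiv g).
    by rewrite lt_neqAle hy andbT; apply/eqP => e; move: hd; rewrite ex -e; lia.
  by rewrite lt_neqAle hz andbT; apply/eqP => e; move: hd; rewrite ex -e; lia.
case: (selY g =P 0) => ey.
  exists (sel_rot (sel_rot g)); split; rewrite ?x2 ?y2 ?z2 ?x1 ?y1 ?z1 //; last by lia.
    exact: sl2_trans hg (sl2_trans (sel_rot_equiv g) (sel_rot_equiv _)).
  by rewrite lt_neqAle hz andbT; apply/eqP => e; move: hd; rewrite ey -e; lia.
by exists g; split=> //; lia.
Qed.

(** Twice the hexagonal form x^2 + xy + y^2. *)
Definition A2_norm (x y : int) : int := x * x + y * y + (x + y) * (x + y).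

Lemma A2_norm_ge2 x y : ~ (x = 0 /\ y = 0) -> 2 <= A2_norm x y.
Proof. rewrite /A2_norm => h; nia. Qed.

Lemma A2_norm_eq2 x y : A2_norm x y = 2 -> (x = -1 \/ x = 0 \/ x = 1) /\ (y = -1 \/ y = 0 \/ y = 1).
Proof.
rewrite /A2_norm => h.
have hx : x * x <= 2 by nia.
have hy : y * y <= 2 by nia.
have : -1 <= x <= 1 by nia.
have : -1 <= y <= 1 by nia.
lia.
Qed.

Lemma sel_sum_act f al be ga de :
  2 * sel_sum (bqf_act f al be ga de) =
  selX f * A2_norm al be + selY f * A2_norm ga de + selZ f * A2_norm (al - ga) (be - de).
Proof. by case: f => [[a b] c]; rewrite /sel_sum /A2_norm /selX /selY /selZ; bunf; ring. Qed.

Lemma det1_rows (al be ga de : int) : al * de - be * ga = 1 ->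
  [/\ 2 <= A2_norm al be, 2 <= A2_norm ga de & 2 <= A2_norm (al - ga) (be - de)].
Proof.
move=> h; split; apply: A2_norm_ge2 => -[h1 h2].
- by move: h; rewrite h1 h2 !mul0r.
- by move: h; rewrite h1 h2 !mulr0.
have e1 : al = ga by lia.
have e2 : be = de by lia.
by move: h; rewrite e1 e2 mulrC subrr.
Qed.

(** The two rows of the substitution and their difference are nonzero, so each norm in [sel_sum_act]
    is at least 2, its value for the identity. *)
Lemma sel_sum_act_ge f al be ga de : selling f -> al * de - be * ga = 1 ->
  sel_sum f <= sel_sum (bqf_act f al be ga de).
Proof.
move=> [hx hy hz] h; have [h1 h2 h3] := det1_rows h.
have := sel_sum_act f al be ga de; rewrite /sel_sum.
have := ler_wpM2l hx h1; have := ler_wpM2l hy h2; have := ler_wpM2l hz h3.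
move: (_ * A2_norm _ _) (_ * A2_norm _ _) (_ * A2_norm _ _) => u v w; lia.
Qed.

(* A substitution can only increase the Selling sum, so both directions of the equivalence preserve it; this
   forces the entries of the substitution to be -1, 0 or 1. *)
Lemma selling_unique f g : selling f -> selling g -> sl2_equiv f g -> 0 < selX f -> 0 < selY f ->
  let X := selX f in let Y := selY f in let Z := selZ f in
  let X' := selX g in let Y' := selY g in let Z' := selZ g in
  (X' = X /\ Y' = Y /\ Z' = Z) \/ (X' = Y /\ Y' = Z /\ Z' = X) \/ (X' = Z /\ Y' = X /\ Z' = Y) \/
  (Z = 0 /\ ((X' = Y /\ Y' = X /\ Z' = Z) \/ (X' = X /\ Y' = Z /\ Z' = Y) \/ (X' = Z /\ Y' = Y /\ Z' = X))).
Proof.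
move=> sf sgg hfg hX hY; have le1 : sel_sum g <= sel_sum f.
  by have [a [b [c [d [h ->]]]]] := sl2_sym hfg; apply: sel_sum_act_ge.
have [al [be [ga [de [h eg]]]]] := hfg; have [h1 h2 h3] := det1_rows h.
have := sel_sum_act f al be ga de; rewrite -eg.
case: sf => _ _ hZ.
have m1 : 0 <= selX f * (A2_norm al be - 2) by rewrite mulr_ge0 ?subr_ge0 // ltW.
have m2 : 0 <= selY f * (A2_norm ga de - 2) by rewrite mulr_ge0 ?subr_ge0 // ltW.
have m3 : 0 <= selZ f * (A2_norm (al - ga) (be - de) - 2) by rewrite mulr_ge0 ?subr_ge0.
move=> hs; have hsum : selX f * (A2_norm al be - 2) + selY f * (A2_norm ga de - 2) + selZ f * (A2_norm (al - ga) (be - de) - 2) <= 0.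
  have -> : selX f * (A2_norm al be - 2) + selY f * (A2_norm ga de - 2) + selZ f * (A2_norm (al - ga) (be - de) - 2) = 2 * sel_sum g - 2 * sel_sum f.
    by rewrite hs /sel_sum; ring.
  by lia.
have z1 : selX f * (A2_norm al be - 2) = 0 by lia.
have z2 : selY f * (A2_norm ga de - 2) = 0 by lia.
have z3 : selZ f * (A2_norm (al - ga) (be - de) - 2) = 0 by lia.
have q1 : A2_norm al be = 2 by move/eqP: z1; rewrite mulf_eq0 gt_eqF //= subr_eq0 => /eqP.
have q2 : A2_norm ga de = 2 by move/eqP: z2; rewrite mulf_eq0 gt_eqF //= subr_eq0 => /eqP.
have [e1 e2] := A2_norm_eq2 q1; have [e3 e4] := A2_norm_eq2 q2.
move: sgg z3; rewrite eg; clear -hX hY hZ e1 e2 e3 e4 h q1 q2.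
case: f hX hY hZ => [[a b] c]; rewrite /selling /selX /selY /selZ; bunf => hX hY hZ [gX gY gZ].
move: e1 e2 e3 e4 h q1 q2 gX gY gZ => [->|[->|->]] [->|[->|->]] [->|[->|->]] [->|[->|->]] //; rewrite /A2_norm // => _ _ _ gX gY gZ h3.
all: pick_or.
Qed.

(** * The reduced forms in one class *)

Definition sel_flip (f : bqf) : bqf := (qc f, qb f, qa f).

Lemma sel_flip_sel f : [/\ selX (sel_flip f) = selY f, selY (sel_flip f) = selX f & selZ (sel_flip f) = selZ f].
Proof. by []. Qed.

Definition sel_triple (f : bqf) : int * int * int := (selX f, selY f, selZ f).

Definition rotations (f : bqf) : seq bqf := [:: f; sel_rot f; sel_rot (sel_rot f)].

(** The Selling-reduced forms equivalent to f, without repetition, provided only [selZ f] may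
    vanish. If it does, the middle coefficient is 0 and the mirror image of f is properly equivalent
    to f. *)
Definition sel_class (f : bqf) : seq bqf :=
  if selZ f == 0 then (if selX f == selY f then rotations f else rotations f ++ rotations (sel_flip f))
  else if (selX f == selY f) && (selY f == selZ f) then [:: f] else rotations f.

Lemma sel_triple_rot f : sel_triple (sel_rot f) = (selY f, selZ f, selX f).
Proof. by rewrite /sel_triple; have [-> -> ->] := sel_rot_sel f. Qed.

Lemma sel_triple_rot2 f : sel_triple (sel_rot (sel_rot f)) = (selZ f, selX f, selY f).
Proof. by rewrite /sel_triple; have [-> -> ->] := sel_rot_sel (sel_rot f); have [-> -> ->] := sel_rot_sel f. Qed.

Lemma sel_triple_rotations f : map sel_triple (rotations f) =
  [:: (selX f, selY f, selZ f); (selY f, selZ f, selX f); (selZ f, selX f, selY f)].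
Proof. by rewrite /= sel_triple_rot sel_triple_rot2. Qed.

Lemma hsel_rot X Y Z : hsel Y Z X = hsel X Y Z.
Proof. by rewrite /hsel [in LHS]orbC orbA; case: ifP => _; lia. Qed.

Lemma hsel_swp X Y Z : hsel Y X Z = hsel X Y Z.
Proof. by rewrite /hsel (orbC (Y < 0)); case: ifP => _; lia. Qed.

Lemma sel_weight_rot f : sel_weight (sel_rot f) = sel_weight f.
Proof. by rewrite /sel_weight; have [-> -> ->] := sel_rot_sel f; rewrite hsel_rot. Qed.

Lemma sel_weight_flip f : sel_weight (sel_flip f) = sel_weight f.
Proof. by rewrite /sel_weight; have [-> -> ->] := sel_flip_sel f; rewrite hsel_swp. Qed.

Lemma sel_weight_class f g : g \in sel_class f -> sel_weight g = sel_weight f.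
Proof.
have h3 k : g \in rotations k -> sel_weight g = sel_weight k.
  by rewrite !inE => /or3P[]/eqP ->; rewrite ?sel_weight_rot.
rewrite /sel_class; case: ifP => _.
  case: ifP => _; first exact: h3.
  by rewrite mem_cat => /orP[]/h3 ->; rewrite ?sel_weight_flip.
by case: ifP => _; [rewrite inE => /eqP -> | apply: h3].
Qed.

Lemma uniq_sel_class f : 0 < selX f -> 0 < selY f -> 0 <= selZ f -> uniq (sel_class f).
Proof.
move=> hx hy hz; apply: (map_uniq (f := sel_triple)); rewrite /sel_class.
have [x1 y1 z1] := sel_flip_sel f.
case: eqP => h0; first case: eqP => h1.
- by rewrite sel_triple_rotations /= !inE /eq_op /= /eq_op /= h0; lia.
- by rewrite map_cat !sel_triple_rotations x1 y1 z1 /= !inE /eq_op /= /eq_op /= h0; lia.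
case: ifP => h1; first by [].
by rewrite sel_triple_rotations /= !inE /eq_op /= /eq_op /=; lia.
Qed.

Lemma mem_sel_class f g : 0 < selX f -> 0 < selY f -> 0 <= selZ f ->
  g \in sel_class f <-> selling g /\ sl2_equiv f g.
Proof.
move=> hx hy hz; have [x1 y1 z1] := sel_flip_sel f.
have eqt k l : (selX k = selX l /\ selY k = selY l /\ selZ k = selZ l) -> k == l.
  by case=> h1 [h2 h3]; apply/eqP; apply: sel_inj.
have [rx ry rz] := sel_rot_sel f.
have [rrx rry rrz] : [/\ selX (sel_rot (sel_rot f)) = selZ f, selY (sel_rot (sel_rot f)) = selX f & selZ (sel_rot (sel_rot f)) = selY f].
  by have [-> -> ->] := sel_rot_sel (sel_rot f).
have [tx ty tz] : [/\ selX (sel_rot (sel_flip f)) = selX f, selY (sel_rot (sel_flip f)) = selZ f & selZ (sel_rot (sel_flip f)) = selY f].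
  by have [-> -> ->] := sel_rot_sel (sel_flip f).
have [ttx tty ttz] : [/\ selX (sel_rot (sel_rot (sel_flip f))) = selZ f, selY (sel_rot (sel_rot (sel_flip f))) = selY f & selZ (sel_rot (sel_rot (sel_flip f))) = selX f].
  by have [-> -> ->] := sel_rot_sel (sel_rot (sel_flip f)).
split; last first.
  move=> [sG hg]; have := selling_unique (And3 (ltW hx) (ltW hy) hz) sG hg hx hy.
  cbv zeta => h; rewrite /sel_class.
  have hr : selZ f <> 0 -> g \in rotations f.
    move=> nz; rewrite !inE; case: h => [h|[h|[h|[h _]]]] //; apply/or3P.
    - by apply: Or31; apply: eqt.
    - by apply: Or32; apply: eqt; rewrite rx ry rz.
    - by apply: Or33; apply: eqt; rewrite rrx rry rrz.
  case: eqP => h0; last first.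
    case: ifP => [/andP[/eqP h1 /eqP h2]|_]; last exact: hr.
    by rewrite inE; apply: eqt; move: h h0 h1 h2; clear; lia.
  case: eqP => h1.
    rewrite !inE; apply/or3P; case: h => [h|[h|[h|[_ [h|[h|h]]]]]].
    - by apply: Or31; apply: eqt.
    - by apply: Or32; apply: eqt; rewrite rx ry rz.
    - by apply: Or33; apply: eqt; rewrite rrx rry rrz.
    - by apply: Or31; apply: eqt; case: h => -> [-> ->]; rewrite h1.
    - by apply: Or32; apply: eqt; case: h => -> [-> ->]; rewrite rx ry rz h1.
    - by apply: Or33; apply: eqt; case: h => -> [-> ->]; rewrite rrx rry rrz h1.
  rewrite mem_cat !inE; apply/orP; case: h => [h|[h|[h|[_ [h|[h|h]]]]]].
  - by left; apply/or3P; apply: Or31; apply: eqt.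
  - by left; apply/or3P; apply: Or32; apply: eqt; rewrite rx ry rz.
  - by left; apply/or3P; apply: Or33; apply: eqt; rewrite rrx rry rrz.
  - by right; apply/or3P; apply: Or31; apply: eqt.
  - by right; apply/or3P; apply: Or32; apply: eqt; rewrite tx ty tz.
  - by right; apply/or3P; apply: Or33; apply: eqt; rewrite ttx tty ttz.
have hr k : sl2_equiv f k -> selling k -> g \in rotations k -> selling g /\ sl2_equiv f g.
  move=> hk [kx ky kz]; have [r1 r2 r3] := sel_rot_sel k; have [b1 b2 b3] := sel_rot_sel (sel_rot k).
  rewrite !inE => /or3P[]/eqP ->; split => //.
  - by split; rewrite ?r1 ?r2 ?r3.
  - exact: sl2_trans hk (sel_rot_equiv k).
  - by split; rewrite ?b1 ?b2 ?b3 ?r1 ?r2 ?r3.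
  - exact: sl2_trans hk (sl2_trans (sel_rot_equiv k) (sel_rot_equiv _)).
have sf : selling f by split=> //; apply: ltW.
have hf := sl2_refl f.
rewrite /sel_class; case: eqP => h0; last first.
  by case: ifP => _; [rewrite inE => /eqP -> | apply: hr].
case: ifP => _; first exact: hr.
rewrite mem_cat => /orP[]; first exact: hr.
apply: hr; last by split; rewrite ?x1 ?y1 ?z1 // ltW.
exists 0, (-1), 1, 0; split=> //; move: h0; rewrite /selZ.
by case: (f) => [[a b] c]; rewrite /sel_flip; bunf => h0; congr (_, _, _); lia.
Qed.

Lemma class_sqP (N : nat) f : (0 < N)%N -> posdef_disc N f -> 0 < selX f -> 0 < selY f -> 0 <= selZ f ->
  class_has_mult_sq f <-> selZ f = 0 /\ selX f = selY f.
Proof.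
move=> N0 hf hx hy hz; split=> [[k hk]|].
  have [_ [k0 _]] := posdef_equiv hf N0 hk; rewrite /qa /= in k0.
  have sk : selling (k, 0, k) by rewrite /selling /selX /selY /selZ; bunf; split; lia.
  have := selling_unique (And3 (ltW hx) (ltW hy) hz) sk hk hx hy.
  move: hx hy hz; rewrite /= ; move: (selX f) (selY f) (selZ f) => X Y Z.
  rewrite /selX /selY /selZ; bunf; clear -k0; lia.
case: (f) => [[a b] c]; rewrite /selX /selY /selZ; bunf => -[h1 h2]; exists a.
have -> : b = 0 by lia.
have -> : c = a by lia.
exact: sl2_refl.
Qed.

Lemma sl2_S (f : bqf) : sl2_equiv f (qc f, - qb f, qa f).
Proof. by exists 0, (-1), 1, 0; split=> //; case: (f) => [[a b] c]; bunf; congr (_, _, _); ring. Qed.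

Lemma class_hexP (N : nat) f : (0 < N)%N -> posdef_disc N f -> 0 < selX f -> 0 < selY f -> 0 <= selZ f ->
  class_has_mult_hex f <-> selX f = selY f /\ selY f = selZ f.
Proof.
move=> N0 hf hx hy hz; split=> [[k hk]|].
  have [_ [k0 _]] := posdef_equiv hf N0 hk; rewrite /qa /= in k0.
  (* The form (k, k, k) has [selZ] equal to -k and is not reduced; (k, -k, k) is, with all three
     parameters k. *)
  have {}hk := sl2_trans hk (sl2_S _); rewrite /qa /qb /qc /= in hk.
  have sk : selling (k, -k, k) by rewrite /selling /selX /selY /selZ; bunf; split; lia.
  have := selling_unique (And3 (ltW hx) (ltW hy) hz) sk hk hx hy.
  move: hx hy hz; rewrite /= ; move: (selX f) (selY f) (selZ f) => X Y Z.
  rewrite /selX /selY /selZ; bunf; clear -k0; lia.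
case: (f) => [[a b] c]; rewrite /selX /selY /selZ; bunf => -[h1 h2]; exists a.
have -> : b = - a by lia.
have -> : c = a by lia.
by have := sl2_S (a, - a, a); rewrite /qa /qb /qc /= opprK.
Qed.

(** Number of reduced forms times weight is 3 x 2 or 6 x 1 for an ordinary class, 3 x 1 for a
    multiple of x^2 + y^2, and 1 x 2 in the hexagonal case. *)
Lemma sum_sel_class (N : nat) f : (0 < N)%N -> posdef_disc N f -> 0 < selX f -> 0 < selY f -> 0 <= selZ f ->
  (\sum_(g <- sel_class f) sel_weight g)%:~R = 6 * class_weight f.
Proof.
move=> N0 hf hx hy hz.
have -> : \sum_(g <- sel_class f) sel_weight g = (size (sel_class f))%:Z * sel_weight f.
  elim: (sel_class f) (@sel_weight_class f) => [|g l IH] hl; first by rewrite big_nil mul0r.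
  rewrite big_cons IH => [|k hk]; last by apply: hl; rewrite inE hk orbT.
  by rewrite hl ?mem_head // /= -add1n PoszD mulrDl mul1r.
have sq := class_sqP N0 hf hx hy hz; have hex := class_hexP N0 hf hx hy hz.
rewrite /class_weight /sel_class /sel_weight /hsel !ltNge (ltW hx) (ltW hy) hz /= (gt_eqF hx) (gt_eqF hy) ?subr0.
case: excluded_middle_informative => [h0|n1].
  have [h1 h2] := sq.1 h0; by rewrite h1 h2 !eqxx.
case: excluded_middle_informative => [h0|n2].
  have [h1 h2] := hex.1 h0; by rewrite -h2 h1 !eqxx gt_eqF //= subr0.
case: (selZ f =P 0) => h0.
  by case: eqP => // h1; case: n1; apply/sq.
by case: ifP => [/andP[/eqP h1 /eqP h2]|_] //; case: n2; apply/hex.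
Qed.

Lemma class_weight_equiv f g : sl2_equiv f g -> class_weight f = class_weight g.
Proof.
move=> h; rewrite /class_weight.
have sq : class_has_mult_sq f <-> class_has_mult_sq g.
  by split=> -[k hk]; exists k; [apply: sl2_trans (sl2_sym h) hk | apply: sl2_trans h hk].
have hex : class_has_mult_hex f <-> class_has_mult_hex g.
  by split=> -[k hk]; exists k; [apply: sl2_trans (sl2_sym h) hk | apply: sl2_trans h hk].
case: excluded_middle_informative => h1; case: (excluded_middle_informative (class_has_mult_sq g)) => h2 //.
- by case: h2; apply: sq.1.
- by case: h1; apply: sq.2.
case: excluded_middle_informative => h3; case: (excluded_middle_informative (class_has_mult_hex g)) => h4 //.
- by case: h4; apply: hex.1.
- by case: h3; apply: hex.2.
Qed.

(** * Class numbers as weighted sums over forms *)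

Definition posdef_forms (N : nat) : seq bqf :=
  [seq f <- [seq (x, c) | x <- [seq (a, b) | a <- sym_range N, b <- sym_range N], c <- sym_range N]
   | [&& disc f == - N%:Z, 0 < qa f & 0 < qc f]].

Lemma uniq_posdef_forms N : uniq (posdef_forms N).
Proof.
rewrite filter_uniq // allpairs_uniq ?uniq_sym_range // => [|[? ?] [? ?] _ _ [-> ->] //].
by rewrite allpairs_uniq ?uniq_sym_range // => -[? ?] [? ?] _ _ [-> ->].
Qed.

Lemma posdef_formsP N f : f \in posdef_forms N -> posdef_disc N f.
Proof. by rewrite mem_filter => /andP[/and3P[/eqP h1 h2 h3] _]. Qed.

Lemma sel_weight_selling f : sel_weight f != 0 -> selling f.
Proof. by move/hsel_neq0. Qed.

Lemma mem_posdef_forms N f : (0 < N)%N -> posdef_disc N f -> sel_weight f != 0 -> f \in posdef_forms N.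
Proof.
move=> N0 hf /sel_weight_selling [hx hy hz]; rewrite mem_filter.
case: (hf) => hd [ha hc]; rewrite hd eqxx ha hc !andTb.
have hs := disc_sel f; rewrite hd opprK in hs.
have bX : 0 < selY f + selZ f -> selX f <= N%:Z by rewrite hs; apply: sym2_bound.
have bY : 0 < selZ f + selX f -> selY f <= N%:Z.
  by move/(sym2_bound hy hz hx); rewrite hs; lia.
have bZ : 0 < selX f + selY f -> selZ f <= N%:Z.
  by move/(sym2_bound hz hx hy); rewrite hs; lia.
have n1 : 0 < selY f + selZ f.
  rewrite lt_neqAle addr_ge0 // andbT; apply/eqP => h0.
  have e1 : selY f = 0 by lia.
  have e2 : selZ f = 0 by lia.
  by move: hs; rewrite e1 e2 !mulr0 mul0r; lia.
have n2 : 0 < selZ f + selX f.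
  rewrite lt_neqAle addr_ge0 // andbT; apply/eqP => h0.
  have e1 : selX f = 0 by lia.
  have e2 : selZ f = 0 by lia.
  by move: hs; rewrite e1 e2 !mulr0 mul0r; lia.
have n3 : 0 < selX f + selY f.
  rewrite lt_neqAle addr_ge0 // andbT; apply/eqP => h0.
  have e1 : selX f = 0 by lia.
  have e2 : selY f = 0 by lia.
  by move: hs; rewrite e1 e2 !mulr0 mul0r; lia.
have [ba bb bc] : [/\ `|qa f| <= N%:Z, `|qb f| <= N%:Z & `|qc f| <= N%:Z].
  by move: ha hc hx hy hz (bX n1) (bY n2) (bZ n3); rewrite /selX /selY /selZ; clear; split; lia.
apply/allpairsPdep; exists (qa f, qb f), (qc f); split; rewrite ?mem_sym_range //; last by case: (f) => [[]].
by apply/allpairsPdep; exists (qa f), (qb f); rewrite !mem_sym_range.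
Qed.

Definition sl2_equivb (f g : bqf) : bool := if excluded_middle_informative (sl2_equiv f g) then true else false.

Lemma sl2_equivP f g : reflect (sl2_equiv f g) (sl2_equivb f g).
Proof. by rewrite /sl2_equivb; case: excluded_middle_informative => h; constructor. Qed.

Lemma sum_equiv_class N f : (0 < N)%N -> posdef_disc N f ->
  (\sum_(g <- posdef_forms N | sl2_equivb f g) sel_weight g)%:~R = 6 * class_weight f.
Proof.
move=> N0 hf; have [f0 [hf0 hx hy hz]] := selling_exists_pos N0 hf.
have pf0 := posdef_equiv hf N0 hf0.
rewrite (class_weight_equiv hf0) -(sum_sel_class N0 pf0 hx hy hz); congr (_%:~R).
rewrite -big_filter; apply: (sum_reindex (f := id) (g := id)); first by rewrite filter_uniq ?uniq_posdef_forms.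
- exact: uniq_sel_class.
- move=> g; rewrite mem_filter => /andP[/sl2_equivP hg _] nz; split=> //; apply/(mem_sel_class _ hx hy hz).
  by split; [apply: sel_weight_selling | apply: sl2_trans (sl2_sym hf0) hg].
move=> g /(mem_sel_class _ hx hy hz)[_ hg] nz; split=> //; rewrite mem_filter.
have hfg := sl2_trans hf0 hg; apply/andP; split; first exact/sl2_equivP.
exact: mem_posdef_forms (posdef_equiv hf N0 hfg) nz.
Qed.

(** The representatives list each class once, so every form is met exactly once in the double sum.
    In particular the count does not depend on the representatives. *)
Lemma weighted_count_sum N h : (0 < N)%N -> is_weighted_class_count N h ->
  6 * h = (\sum_(g <- posdef_forms N) sel_weight g)%:~R.
Proof.
move=> N0 [s [hs [hinj [hcov ->]]]].
have us : uniq s.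
  by apply/(uniqP (0, 0, 0)) => i j hi hj e; apply: hinj => //; rewrite e; apply: sl2_refl.
rewrite mulr_sumr (eq_big_seq (fun f => (\sum_(g <- posdef_forms N | sl2_equivb f g) sel_weight g)%:~R)); last first.
  by move=> f hf; rewrite sum_equiv_class //; apply: hs.
rewrite -rmorph_sum /=; congr (_%:~R).
rewrite (eq_bigr (fun f => \sum_(g <- posdef_forms N) (if sl2_equivb f g then sel_weight g else 0))); last by move=> f _; rewrite big_mkcond.
rewrite exchange_big; apply: eq_big_seq => g /posdef_formsP hg.
have [f0 hf0 h0] := hcov g hg.
rewrite (bigD1_seq f0) //= (introT (sl2_equivP _ _) h0) big1_seq ?addr0 // => f /andP[/eqP ne hf].
case: sl2_equivP => // hfg; case: ne; have hff := sl2_trans hfg (sl2_sym h0).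
rewrite -(nth_index (0, 0, 0) hf) -(nth_index (0, 0, 0) hf0); congr nth.
by apply: hinj; rewrite ?index_mem // !nth_index.
Qed.

Fixpoint class_reps (l : seq bqf) : seq bqf :=
  if l is f :: l' then (if has (sl2_equivb f) (class_reps l') then class_reps l' else f :: class_reps l') else [::].

Lemma class_reps_sub l f : f \in class_reps l -> f \in l.
Proof.
elim: l => //= g l IH; case: ifP => _; first by move/IH => h; rewrite inE h orbT.
by rewrite !inE => /orP[->|/IH ->] //; rewrite orbT.
Qed.

Lemma class_reps_cover l f : f \in l -> exists2 g, g \in class_reps l & sl2_equiv g f.
Proof.
elim: l => //= k l IH; rewrite inE => /orP[/eqP ->|/IH[g hg hgf]].
  case: ifP => [/hasP[g hg /sl2_equivP h]|_]; first by exists g => //; apply: sl2_sym.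
  by exists k; [exact: mem_head | exact: sl2_refl].
by exists g => //; case: ifP => // _; rewrite inE hg orbT.
Qed.

Lemma class_reps_inj l i j : (i < size (class_reps l))%N -> (j < size (class_reps l))%N ->
  sl2_equiv (nth (0, 0, 0) (class_reps l) i) (nth (0, 0, 0) (class_reps l) j) -> i = j.
Proof.
elim: l i j => //= k l IH i j; case: ifP => h; first exact: IH.
have nk m : (m < size (class_reps l))%N -> ~ sl2_equiv k (nth (0, 0, 0) (class_reps l) m).
  by move=> hm hk; case/hasP: h; exists (nth (0, 0, 0) (class_reps l) m); [exact: mem_nth | apply/sl2_equivP].
case: i => [|i]; case: j => [|j] //= hi hj he.
- by case: (nk j).
- by case: (nk i) => //; apply: sl2_sym.
by rewrite (IH i j).
Qed.

(** Every class has a reduced form in the finite box, so thinning the box gives representatives.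
    This guarantees that the [epsilon] in [H] meets its specification. *)
Lemma weighted_count_exists N : (0 < N)%N -> exists h, is_weighted_class_count N h.
Proof.
move=> N0; exists (\sum_(f <- class_reps (posdef_forms N)) class_weight f), (class_reps (posdef_forms N)).
split; [|split; [exact: class_reps_inj|split=> //]].
  by move=> f /class_reps_sub/posdef_formsP.
move=> g hg; have [f [hf hx hy hz]] := selling_exists_pos N0 hg.
have : f \in posdef_forms N.
  apply: mem_posdef_forms (posdef_equiv hg N0 hf) _ => //; rewrite /sel_weight /hsel !ltNge (ltW hx) (ltW hy) hz /=.
  by rewrite (gt_eqF hx) (gt_eqF hy) !subr0; case: (selZ f == 0).
case/class_reps_cover => k hk hkf; exists k => //; exact: sl2_trans hkf (sl2_sym hf).
Qed.

Lemma hurwitz_sum N : (0 < N)%N -> (N %% 4 != 1)%N -> (N %% 4 != 2)%N ->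
  6 * H N = (\sum_(g <- posdef_forms N) sel_weight g)%:~R.
Proof.
move=> N0 h1 h2; apply: weighted_count_sum => //.
have hsp h : Hurwitz_spec N h <-> is_weighted_class_count N h.
  by rewrite /Hurwitz_spec gtn_eqF // (negPf h1) (negPf h2).
apply/hsp; apply: epsilon_spec; have [h hh] := weighted_count_exists N0.
by exists h; apply/hsp.
Qed.

(** * Matrices of given trace and their forms *)

(* The form whose root in the upper half plane is the fixed point of N. *)
Definition bqf_of_mat (N : mat) : bqf := (- M21 N, M22 N - M11 N, M12 N).
Definition mat_of_bqf (r : int) (f : bqf) : mat := (((r - qb f) %/ 2)%Z, qc f, - qa f, ((r + qb f) %/ 2)%Z).

Lemma tri_weight_sel N : tri_weight N = sel_weight (bqf_of_mat N).
Proof.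
case: N => [[[a b] c] d]; rewrite /tri_weight /hsel_edges /sel_weight /selX /selY /selZ /bqf_of_mat; bunf.
rewrite /M11 /M12 /M21 /M22 /=; congr hsel; ring.
Qed.

Lemma disc_bqf_of_mat N : disc (bqf_of_mat N) = mtr N ^+ 2 - 4 * mdet N.
Proof. case: N => [[[a b] c] d]; rewrite /disc /bqf_of_mat; bunf; munf; ring. Qed.

Lemma selling_qa_ge0 f : selling f -> 0 <= qa f /\ 0 <= qc f.
Proof. by case: f => [[a b] c]; rewrite /selling /selX /selY /selZ; bunf => -[h1 h2 h3]; lia. Qed.

Lemma sum_trace_hurwitz (P n : nat) (r : int) : prime P -> r ^+ 2 + n%:Z = 4 * P%:Z -> (0 < n)%N ->
  (\sum_(N <- det_mats P | mtr N == r) tri_weight N)%:~R = 6 * H n.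
Proof.
move=> hP hr hn; rewrite hurwitz_sum //; last 2 first.
- have [q [e|e]] : exists q, r = 2 * q \/ r = 2 * q + 1 by exists (r %/ 2)%Z; lia.
    by move: hr; rewrite e exprMn -[2 ^+ 2]/(4 : int); move: (q ^+ 2); lia.
  by move: hr; rewrite e sqrrD1 exprMn -[2 ^+ 2]/(4 : int); move: (q ^+ 2); lia.
- have [q [e|e]] : exists q, r = 2 * q \/ r = 2 * q + 1 by exists (r %/ 2)%Z; lia.
    by move: hr; rewrite e exprMn -[2 ^+ 2]/(4 : int); move: (q ^+ 2); lia.
  by move: hr; rewrite e sqrrD1 exprMn -[2 ^+ 2]/(4 : int); move: (q ^+ 2); lia.
have P1 := prime_gt1 hP.
congr (_%:~R); rewrite -big_filter.
have matK f : disc f = - n%:Z -> [/\ mtr (mat_of_bqf r f) = r, mdet (mat_of_bqf r f) = P%:Z & bqf_of_mat (mat_of_bqf r f) = f].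
  case: f => [[a b] c]; rewrite /disc /mat_of_bqf /bqf_of_mat; bunf; munf => hd.
  have e : (r - b) * (r + b) = 4 * (P%:Z - a * c).
    transitivity (r ^+ 2 - b ^+ 2); first by ring.
    have -> : b ^+ 2 = 4 * a * c - n%:Z by rewrite -[RHS]opprK opprB; lia.
    by rewrite opprB addrA hr; ring.
  (* The trace and the middle coefficient have equal parity, since otherwise (r - b)(r + b) would be
     odd; so the halves in [mat_of_bqf] are exact. *)
  have [u [v [e1 e2]]] : exists u v, r - b = 2 * u /\ r + b = 2 * v.
    have [u hu] : exists u, r - b = 2 * u \/ r - b = 2 * u + 1 by exists ((r - b) %/ 2)%Z; lia.
    case: hu => hu; first by exists u, (u + b); lia.
    have : (2 * u + 1) * (2 * (u + b) + 1) = 4 * (P%:Z - a * c).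
      by rewrite -e -hu; congr (_ * _); lia.
    have -> : (2 * u + 1) * (2 * (u + b) + 1) = 2 * (2 * u * (u + b) + u + (u + b)) + 1 by ring.
    by lia.
  have -> : ((r - b) %/ 2)%Z = u by rewrite e1 mulKz.
  have -> : ((r + b) %/ 2)%Z = v by rewrite e2 mulKz.
  have euv : u * v = P%:Z - a * c.
    by apply: (mulfI (_ : 4 != 0 :> int)) => //; rewrite -e e1 e2; ring.
  by split; [lia | rewrite euv; ring | congr (_, _, _); lia].
apply: (sum_reindex (f := bqf_of_mat) (g := mat_of_bqf r)); rewrite ?uniq_posdef_forms //.
- by rewrite !filter_uniq ?uniq_mat_box.
- move=> N; rewrite mem_filter => /andP[/eqP ht]; rewrite [N \in _]mem_filter => /andP[/eqP hd _]; rewrite tri_weight_sel => nz.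
  have hdd : disc (bqf_of_mat N) = - n%:Z by rewrite disc_bqf_of_mat ht hd -hr; ring.
  have [hA hC] := selling_qa_ge0 (sel_weight_selling nz).
  split=> //.
    apply: mem_posdef_forms => //; split=> //.
    move: hdd hA hC; case: N ht hd nz => [[[a b] c] d]; rewrite /disc /bqf_of_mat; bunf; munf => ht hd _ _ hA hC.
    have hns := @prime_nonsquare P _ hP.
    (* If an off-diagonal entry vanished, the diagonal entries would be integer eigenvalues and r^2
       - 4P a square, whereas it equals -n. *)
    have hne (x y : int) : x + y = r -> x * y = P%:Z -> 0 < n%:Z -> False.
      move=> e1 e2 n0; have := sqr_ge0 (x - y).
      have -> : (x - y) ^+ 2 = r ^+ 2 - 4 * P%:Z by rewrite -e1 -e2; ring.
      by rewrite -hr; lia.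
    split; rewrite lt_neqAle ?hA ?hC andbT; apply/eqP => h0; apply: (hne a d) => //.
    - by rewrite -hd -[c]opprK -h0 oppr0 mulr0 subr0.
    - by rewrite -hd -h0 mul0r subr0.
  case: N ht hd {nz hdd hA hC} => [[[a b] c] d]; rewrite /mat_of_bqf /bqf_of_mat; bunf; munf => ht hd.
  have -> : r - (d - a) = 2 * a by rewrite -ht; ring.
  have -> : r + (d - a) = 2 * d by rewrite -ht; ring.
  by rewrite !mulKz // opprK.
move=> f /posdef_formsP[hd _] nz; have [h1 h2 h3] := matK f hd.
have nz' : tri_weight (mat_of_bqf r f) != 0 by rewrite tri_weight_sel h3.
by rewrite tri_weight_sel h3; split=> //; rewrite mem_filter h1 eqxx mem_det_mats // h2 eqxx.
Qed.

Lemma tri_weight_trace (P : nat) N : prime P -> mdet N = P%:Z -> tri_weight N != 0 -> mtr N ^+ 2 < 4 * P%:Z.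
Proof.
move=> hP hd; rewrite tri_weight_sel => /sel_weight_selling[hx hy hz].
have := disc_sel (bqf_of_mat N); rewrite disc_bqf_of_mat hd opprB => e.
rewrite lt_neqAle -subr_ge0 e !addr_ge0 ?mulr_ge0 // andbT.
apply/eqP => e2; have [q [h|h]] : exists q, mtr N = 2 * q \/ mtr N = 2 * q + 1 by exists (mtr N %/ 2)%Z; lia.
  by apply: (@prime_nonsquare P q hP); move: e2; rewrite h exprMn expr2; lia.
by move: e2; rewrite h sqrrD1 exprMn; lia.
Qed.

(** Minus the adjugate has the same form and determinant as N and the opposite trace. *)
Lemma sum_trace_neg (P : nat) (c : int) : prime P ->
  \sum_(N <- det_mats P | (3 %| mtr N - c)%Z) tri_weight N = \sum_(N <- det_mats P | (3 %| mtr N + c)%Z) tri_weight N.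
Proof.
move=> hP; pose f (N : mat) : mat := (- M22 N, M12 N, M21 N, - M11 N).
have ff N : f (f N) = N by case: N => [[[a b] d] e]; rewrite /f /M11 /M12 /M21 /M22 /= !opprK.
have fh N : tri_weight (f N) = tri_weight N.
  by rewrite !tri_weight_sel; congr sel_weight; case: N => [[[a b] d] e]; rewrite /f /bqf_of_mat; munf; congr (_, _, _); ring.
have fd N : mdet (f N) = mdet N by case: N => [[[a b] d] e]; rewrite /f; munf; ring.
have ft N : mtr (f N) = - mtr N by case: N => [[[a b] d] e]; rewrite /f; munf; ring.
rewrite -big_filter -[RHS]big_filter; apply: (sum_reindex (f := f) (g := f)); rewrite ?filter_uniq ?uniq_mat_box //.
  move=> N; rewrite mem_filter => /andP[h3 hN'] nz; rewrite ff fh; split=> //.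
  rewrite mem_filter ft -rpredN opprD !opprK h3 mem_det_mats ?fh // fd.
  by move: hN'; rewrite mem_det_mats.
move=> N; rewrite mem_filter => /andP[h3 hN'] nz; rewrite ff fh; split=> //.
rewrite mem_filter ft -rpredN opprB opprK addrC h3 mem_det_mats ?fh // fd.
by move: hN'; rewrite mem_det_mats.
Qed.

Lemma sum_H_trace (p : nat) (c : int) : prime p ->
  6 * (\sum_(i < (4 * p).+1 |
            let r : int := i%:Z - (2 * p)%:Z in
            (r ^+ 2 < (4 * p)%:Z) && ((r - c) %% 3 == 0)%Z)
      H `|(4 * p)%:Z - (i%:Z - (2 * p)%:Z) ^+ 2|%N) =
  (\sum_(N <- det_mats p | (3 %| mtr N - c)%Z) tri_weight N)%:~R.
Proof.
move=> hp; have p1 := prime_gt1 hp.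
rewrite mulr_sumr (eq_bigr (fun i : 'I_(4 * p).+1 => (\sum_(N <- det_mats p | mtr N == i%:Z - (2 * p)%:Z) tri_weight N)%:~R)); last first.
  move=> i /andP[h _]; rewrite (@sum_trace_hurwitz p `|(4 * p)%:Z - (i%:Z - (2 * p)%:Z) ^+ 2|%N (i%:Z - (2 * p)%:Z)) //.
    by move: h; move: (_ ^+ 2); lia.
  by move: h; move: (_ ^+ 2); lia.
rewrite -rmorph_sum /=; congr (_%:~R).
rewrite (eq_bigr (fun i : 'I_(4 * p).+1 => \sum_(N <- det_mats p) (if mtr N == i%:Z - (2 * p)%:Z then tri_weight N else 0))); last first.
  by move=> i _; rewrite big_mkcond.
rewrite exchange_big [RHS]big_mkcond; apply: eq_big_seq => N; rewrite mem_filter => /andP[/eqP hd _].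
case: (tri_weight N =P 0) => [-> | /eqP nz].
  by rewrite big1 => [|i _]; case: ifP.
have ht := tri_weight_trace hp hd nz.
(* The square of the trace is below 4p, so the trace lies between -2p and 2p and occurs as exactly
   one index. *)
have hi : (absz (mtr N + (2 * p)%:Z)%R < (4 * p).+1)%N.
  have : `|mtr N| <= 2 * p%:Z by move: ht; rewrite expr2; move: (mtr N); nia.
  by move: (mtr N); lia.
have e0 : (absz (mtr N + (2 * p)%:Z)%R)%:Z - (2 * p)%:Z = mtr N.
  have : `|mtr N| <= 2 * p%:Z by move: ht; rewrite expr2; move: (mtr N); nia.
  by move: (mtr N); lia.
rewrite big_mkcond (bigD1 (Ordinal hi)) //= big1 ?addr0.
  rewrite e0 eqxx; have -> : mtr N ^+ 2 < (4 * p)%N%:Z by move: ht; move: (_ ^+ 2); lia.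
  by rewrite /=; move: (mtr N - c) => x; case: eqP; case: ifP => //; lia.
move=> i /eqP ne; case: ifP => // _; case: eqP => // e; case: ne; apply: val_inj => /=.
by move: e e0; move: (mtr N); lia.
Qed.

(** * Evaluation of the class number sums in the four cases *)

Unset Implicit Arguments.

(* The sum over r in Z with |r| < 2 sqrt p (i.e. r^2 < 4p) and r = c mod 3 is
   indexed by i < 4p+1 with r = i - 2p. *)
Theorem theorem3 (p : nat) (c : int) (hp : prime p) :
  let S : rat :=
    \sum_(i < (4 * p).+1 |
            let r : int := i%:Z - (2 * p)%:Z in
            (r ^+ 2 < (4 * p)%:Z) && ((r - c) %% 3 == 0)%Z)
      H `|(4 * p)%:Z - (i%:Z - (2 * p)%:Z) ^+ 2|%N in
  [/\ ((c %% 3)%Z == 0) && (p %% 3 == 1)%N -> S = (p%:R + 1) / 2,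
      ((c %% 3)%Z == 0) && (p %% 3 == 2)%N -> S = p%:R - 1,
      ((c %% 3)%Z != 0) && (p %% 3 == 1)%N -> S = (3 * p%:R - 1) / 4
    & ((c %% 3)%Z != 0) && (p %% 3 == 2)%N -> S = (p%:R + 1) / 2].
Proof.
move=> S; have hS : 6 * S = _ := sum_H_trace c hp; move: S hS => S hS.
have zero : (c %% 3)%Z == 0 -> \sum_(N <- det_mats p | (3 %| mtr N - c)%Z) tri_weight N = \sum_(N <- det_mats p | (3 %| mtr N)%Z) tri_weight N.
  by move=> hc; apply: eq_bigl => N; move: (mtr N) hc => t; clear; lia.
(* The residues c and -c exhaust the traces prime to 3 and have equal sums by [sum_trace_neg]. *)
have nonzero : (c %% 3)%Z != 0 -> 2 * \sum_(N <- det_mats p | (3 %| mtr N - c)%Z) tri_weight N = \sum_(N <- det_mats p | ~~ (3 %| mtr N)%Z) tri_weight N.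
  move=> hc; rewrite mulrDl mul1r {2}sum_trace_neg // [X in X + _]big_mkcond [X in _ + X]big_mkcond [RHS]big_mkcond -big_split /=.
  apply: eq_bigr => N _; move: (mtr N) (tri_weight N) => t h.
  by do 3 (case: ifP => ?); rewrite ?addr0 ?add0r //; exfalso; lia.
have split3 := sum_trace_split hp.
have cast (a b : int) : (a * p%:Z + b)%:~R = a%:~R * p%:R + b%:~R :> rat by rewrite intrD intrM.
split=> /andP[hc /eqP h3].
- have := zero hc; rewrite sum_trace_mod1 // => e; rewrite e cast in hS; lra.
- have := zero hc; rewrite sum_trace_mod2 // => e; rewrite e mulrBr mulr1 cast in hS; lra.
- have e1 := nonzero hc; rewrite sum_trace_mod1 // in split3.
  have e2 : 2 * \sum_(N <- det_mats p | (3 %| mtr N - c)%Z) tri_weight N = 9 * p%:Z + -3 by rewrite e1; lia.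
  by have := cast 9 (-3); rewrite -e2 intrM -hS; lra.
have e1 := nonzero hc; rewrite sum_trace_mod2 // in split3.
have e2 : 2 * \sum_(N <- det_mats p | (3 %| mtr N - c)%Z) tri_weight N = 6 * p%:Z + 6 by rewrite e1; lia.
by have := cast 6 6; rewrite -e2 intrM -hS; lra.
Qed.
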